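(* Let $M \models \mathsf{ZFC}$ be countable. Then every countable partial order embeds into $\mathrm{Re}_{\mathsf{GBC}}(M)$, the collection of $\mathsf{GBC}$-realizations for $M$ ordered by $\subseteq$. More generally, for every finite partial order $P$ and every countable $\mathcal X \in \mathrm{Re}_{\mathsf{GBC}}(M)$ there is an embedding $e : P \to \mathrm{Re}_{\mathsf{GBC}}(M)$ which maps $P$ above $\mathcal X$, that is, $e(p) \supseteq \mathcal X$ for all $p \in P$.
   Context: Second-order set theory is formalized in two-sorted first-order logic, with sets and classes. A model is a pair $(M,\mathcal X)$ where $M$ (with its membership relation) is the universe of sets and $\mathcal X \subseteq \mathcal P(M)$ is the collection of classes. A formula is first-order if it has no class quantifiers (class parameters are allowed). $\mathsf{GBC}$ consists of: $\mathsf{ZFC}$ for sets; Extensionality for classes; Class Replacement (if $F$ is a class function and $a$ a set then $F''a$ is a set); Global Choice (there is a class bijection $\mathrm{Ord}\to V$); and Elementary Comprehension ($\{x : \phi(x)\}$ is a class for every first-order $\phi$ with set and class parameters). For a model $M$ of first-order set theory (not necessarily well-founded), a $\mathsf{GBC}$-realization for $M$ is a set $\mathcal X \subseteq \mathcal P(M)$ with $(M,\mathcal X)\models \mathsf{GBC}$. $\mathrm{Re}_{\mathsf{GBC}}(M)$ is the set of all $\mathsf{GBC}$-realizations for $M$, partially ordered by inclusion. An embedding $e$ of a partial order $P$ is a map with $p \le q \iff e(p) \subseteq e(q)$. *)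

(* Defs.v *)
From HB Require Import structures.
From mathcomp Require Import all_boot all_order.
From mathcomp Require Import boolp classical_sets functions cardinality.

Set Implicit Arguments.
Unset Strict Implicit.
Unset Printing Implicit Defensive.

Local Open Scope classical_set_scope.

(* Formulas of two-sorted set theory without class quantifiers. Set variables
   are de Bruijn indices; class variables, never quantified, are drawn from K.
   The language of first-order set theory is the case K = void. *)
Inductive formula (K : Type) : Type :=
| FMem (i j : nat)
| FEq (i j : nat)
| FMemClass (i : nat) (k : K)
| FEqClass (k l : K)
| FBot
| FImp (f g : formula K)
| FAll (f : formula K).

Arguments FMem {K}.
Arguments FEq {K}.
Arguments FBot {K}.

Definition scons (M : Type) (x : M) (s : nat -> M) : nat -> M :=
  fun n => if n is m.+1 then s m else x.

Fixpoint sat (K M : Type) (E : M -> M -> Prop) (C : K -> set M)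
    (s : nat -> M) (f : formula K) : Prop :=
  match f with
  | FMem i j => E (s i) (s j)
  | FEq i j => s i = s j
  | FMemClass i k => C k (s i)
  | FEqClass k l => C k = C l
  | FBot => False
  | FImp g h => sat E C s g -> sat E C s h
  | FAll g => forall x : M, sat E C (scons x s) g
  end.

Definition no_class (M : Type) (k : void) : set M := match k with end.

(* The relation E x y reads "x is an element of y in M"; it need be neither
   the true membership relation nor well-founded. *)
Section Notions.
Variables (M : Type) (E : M -> M -> Prop).

Definition is_upair (p x y : M) : Prop := forall z, E z p <-> z = x \/ z = y.

Definition is_opair (p x y : M) : Prop :=
  exists u v, [/\ is_upair u x x, is_upair v x y & is_upair p u v].

Definition is_ordinal (a : M) : Prop :=
  [/\ forall x y, E x a -> E y x -> E y a,
      forall x, E x a -> ~ E x x,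
      forall x y z, E x a -> E y a -> E z a -> E x y -> E y z -> E x z,
      forall x y, E x a -> E y a -> [\/ E x y, x = y | E y x]
    & forall b, (forall x, E x b -> E x a) -> (exists x, E x b) ->
        exists2 m, E m b & forall x, E x b -> m = x \/ E m x].

Definition maps_to (F : set M) (x y : M) : Prop :=
  exists2 p, F p & is_opair p x y.

Definition class_function (F : set M) : Prop :=
  (forall p, F p -> exists x y, is_opair p x y) /\
  (forall x y y', maps_to F x y -> maps_to F x y' -> y = y').

Definition bijection_Ord_V (F : set M) : Prop :=
  [/\ class_function F,
      forall x, is_ordinal x <-> exists y, maps_to F x y,
      forall x x' y, maps_to F x y -> maps_to F x' y -> x = x'
    & forall y, exists x, maps_to F x y].

Record ZFC : Prop := {
  zfc_extensionality :
    forall x y, (forall z, E z x <-> E z y) -> x = y;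
  zfc_foundation :
    forall x, (exists y, E y x) ->
      exists2 y, E y x & ~ exists2 z, E z y & E z x;
  zfc_pairing :
    forall x y, exists p, is_upair p x y;
  zfc_union :
    forall a, exists u, forall x, E x u <-> exists2 y, E y a & E x y;
  zfc_powerset :
    forall a, exists p, forall x, E x p <-> forall z, E z x -> E z a;
  zfc_infinity :
    exists w, (exists2 e, E e w & forall z, ~ E z e) /\
      (forall x, E x w ->
         exists2 y, E y w & forall z, E z y <-> E z x \/ z = x);
  zfc_separation :
    forall (f : formula void) (s : nat -> M) (a : M),
      exists b, forall x,
        E x b <-> E x a /\ sat E (@no_class M) (scons x s) f;
  zfc_replacement :
    forall (f : formula void) (s : nat -> M) (a : M),
      let phi x y := sat E (@no_class M) (scons x (scons y s)) f in
      (forall x y y', E x a -> phi x y -> phi x y' -> y = y') ->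
      exists b, forall y, E y b <-> exists2 x, E x a & phi x y;
  zfc_choice :
    forall a, (forall x, E x a -> exists z, E z x) ->
      (forall x y z, E x a -> E y a -> E z x -> E z y -> x = y) ->
      exists c, forall x, E x a -> exists! z, E z x /\ E z c
}.

Record GBC (X : set (set M)) : Prop := {
  gbc_ZFC : ZFC;
  gbc_extensionality :
    forall A B, X A -> X B -> (forall x, A x <-> B x) -> A = B;
  gbc_class_replacement :
    forall F, X F -> class_function F ->
      forall a, exists b, forall y, E y b <-> exists2 x, E x a & maps_to F x y;
  gbc_global_choice :
    exists2 F, X F & bijection_Ord_V F;
  gbc_elementary_comprehension :
    forall (f : formula nat) (s : nat -> M) (C : nat -> set M),
      (forall k, X (C k)) -> X [set x | sat E C (scons x s) f]
}.

Definition Re_GBC : set (set (set M)) := [set X | GBC X].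

End Notions.

Definition order_embedding (d : Order.disp_t) (P : porderType d) (T : Type)
    (e : P -> set T) : Prop :=
  forall p q : P, (p <= q)%O <-> e p `<=` e q.

(* Main.v *)
Require Import Defs.
From HB Require Import structures.
From mathcomp Require Import all_boot all_order.
From mathcomp Require Import boolp classical_sets functions cardinality.

(** Class forcing over a countable base [(M, X)].  The posets used consist of
    sets ordered by reverse inclusion and are closed under unions of set-sized
    chains, so set-many open dense classes have dense intersection.  Hence a
    class function definable from the generic agrees, on any given set, with one
    definable in the ground model, and Class Replacement survives.

    Starting from the definable classes of [M], forcing with injections from
    ordinals into [V] gives a countable realization satisfying Global Choice.
    Over a countable realization [X], force with partial functions from [V] to 2
    and cut the generic into disjoint proper-class slices [G_q], [q] in [P].  The
    embedding sends [p] to the classes definable from [X] and the [G_q] with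
    [q <= p].  If [p] is not below [q], then [G_p] is not in [e q]: forcing of
    statements about the other slices ignores what a condition says on slice
    [p], so a condition forcing a definition of [G_p] could be extended so as to
    contradict it. *)

Set Implicit Arguments.
Unset Strict Implicit.
Unset Printing Implicit Defensive.

Local Open Scope classical_set_scope.

(** * Definability *)

Section Definability.
Variables (M : Type) (E : M -> M -> Prop).

(* First-order definable predicates of assignments, with class parameters from
   [Y]; set parameters are available once [Y] contains all singletons. *)
Inductive dfn (Y : set (set M)) : ((nat -> M) -> Prop) -> Prop :=
| dfn_mem0 i j : dfn Y (fun s => E (s i) (s j))
| dfn_eq0 i j : dfn Y (fun s => s i = s j)
| dfn_cls0 i A : Y A -> dfn Y (fun s => A (s i))
| dfn_bot : dfn Y (fun _ => False)
| dfn_imp P Q : dfn Y P -> dfn Y Q -> dfn Y (fun s => P s -> Q s)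
| dfn_all0 P : dfn Y P -> dfn Y (fun s => forall x, P (scons x s)).

(* The graph of [t] is definable; variable 0 stands for the value. *)
Definition dterm (Y : set (set M)) (t : (nat -> M) -> M) : Prop :=
  dfn Y (fun s => t (fun n => s n.+1) = s 0).

End Definability.

(** Arguments range over all definable terms rather than over variables, so that proof search can
    descend through nested applications. *)
Notation dpred1 E Y Q :=
  (forall t, dterm E Y t -> dfn E Y (fun s => Q (t s))).
Notation dpred2 E Y Q := (forall t u, dterm E Y t -> dterm E Y u ->
  dfn E Y (fun s => Q (t s) (u s))).
Notation dfun1 E Y F :=
  (forall t, dterm E Y t -> dterm E Y (fun s => F (t s))).
Notation dfun2 E Y F := (forall t u, dterm E Y t -> dterm E Y u ->
  dterm E Y (fun s => F (t s) (u s))).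

Section Closure.
Variables (M : Type) (E : M -> M -> Prop).
Variables (Y : set (set M)) (singY : forall c, Y [set c]).
Implicit Types P Q R S T : (nat -> M) -> Prop.

Lemma dfn_ext P Q : (forall s, P s <-> Q s) -> dfn E Y P -> dfn E Y Q.
Proof.
move=> PQ dP; suff -> : Q = P by [].
by apply/funext => s; apply/propext; split=> /PQ.
Qed.

Lemma dfn_all (P : (nat -> M) -> M -> Prop) :
  dfn E Y (fun s => P (fun n => s n.+1) (s 0)) ->
  dfn E Y (fun s => forall x, P s x).
Proof. by move=> dP; apply: (dfn_ext _ (dfn_all0 dP)). Qed.

Lemma dfn_not P : dfn E Y P -> dfn E Y (fun s => ~ P s).
Proof. by move=> dP; apply: dfn_imp => //; apply: dfn_bot. Qed.

Lemma dfn_and P Q : dfn E Y P -> dfn E Y Q -> dfn E Y (fun s => P s /\ Q s).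
Proof.
move=> dP dQ; apply: dfn_ext (dfn_not (dfn_imp dP (dfn_not dQ))) => s; split.
  by move=> h; split; apply: contrapT => k; apply: h => // p q; apply: k.
by move=> [p q]; apply.
Qed.

Lemma dfn_or P Q : dfn E Y P -> dfn E Y Q -> dfn E Y (fun s => P s \/ Q s).
Proof.
move=> dP dQ; apply: dfn_ext (dfn_imp (dfn_not dP) dQ) => s; split.
  by move=> h; have [p|/h q] := pselect (P s); [left|right].
by case.
Qed.

Lemma dfn_and3 P Q R : dfn E Y P -> dfn E Y Q -> dfn E Y R ->
  dfn E Y (fun s => [/\ P s, Q s & R s]).
Proof.
move=> dP dQ dR; apply: dfn_ext (dfn_and dP (dfn_and dQ dR)) => s.
by split=> [[? []]|[]].
Qed.

Lemma dfn_and4 P Q R S : dfn E Y P -> dfn E Y Q -> dfn E Y R -> dfn E Y S ->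
  dfn E Y (fun s => [/\ P s, Q s, R s & S s]).
Proof.
move=> dP dQ dR dS; apply: dfn_ext (dfn_and dP (dfn_and3 dQ dR dS)) => s.
by split=> [[? []]|[]].
Qed.

Lemma dfn_and5 P Q R S T : dfn E Y P -> dfn E Y Q -> dfn E Y R -> dfn E Y S ->
  dfn E Y T -> dfn E Y (fun s => [/\ P s, Q s, R s, S s & T s]).
Proof.
move=> dP dQ dR dS dT.
apply: dfn_ext (dfn_and dP (dfn_and4 dQ dR dS dT)) => s.
by split=> [[? []]|[]].
Qed.

Lemma dfn_or3 P Q R : dfn E Y P -> dfn E Y Q -> dfn E Y R ->
  dfn E Y (fun s => [\/ P s, Q s | R s]).
Proof.
move=> dP dQ dR; apply: dfn_ext (dfn_or dP (dfn_or dQ dR)) => s; split.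
  by move=> [?|[?|?]]; [apply: Or31|apply: Or32|apply: Or33].
by move=> [?|?|?]; [left|right; left|right; right].
Qed.

Lemma dfn_iff P Q : dfn E Y P -> dfn E Y Q -> dfn E Y (fun s => P s <-> Q s).
Proof. by move=> dP dQ; apply: dfn_and; apply: dfn_imp. Qed.

Lemma dfn_ex (P : (nat -> M) -> M -> Prop) :
  dfn E Y (fun s => P (fun n => s n.+1) (s 0)) ->
  dfn E Y (fun s => exists x, P s x).
Proof.
move=> dP; pose N s x := ~ P s x.
apply: dfn_ext (dfn_not (dfn_all (P := N) (dfn_not dP))) => s; split.
  by move=> h; apply: contrapT => k; apply: h => x p; apply: k; exists x.
by move=> [x p] /(_ x).
Qed.

Lemma dfn_ex2 (P Q : (nat -> M) -> M -> Prop) :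
  dfn E Y (fun s => P (fun n => s n.+1) (s 0)) ->
  dfn E Y (fun s => Q (fun n => s n.+1) (s 0)) ->
  dfn E Y (fun s => exists2 x, P s x & Q s x).
Proof.
move=> dP dQ.
apply: dfn_ext (dfn_ex (P := fun s x => P s x /\ Q s x) (dfn_and dP dQ)) => s.
by split=> [[x []]|[x]]; exists x.
Qed.

Lemma dfn_const (p : Prop) : dfn E Y (fun _ => p).
Proof.
have [h|h] := pselect p; last by apply: dfn_ext (dfn_bot E Y) => s; split.
by apply: dfn_ext (dfn_not (dfn_bot E Y)) => s; split=> // _ [].
Qed.

Lemma dfn_ren (r : nat -> nat) P :
  dfn E Y P -> dfn E Y (fun s => P (fun n => s (r n))).
Proof.
move=> dP; elim: dP r => {P}.
- by move=> i j r; apply: dfn_mem0.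
- by move=> i j r; apply: dfn_eq0.
- by move=> i A YA r; apply: (dfn_cls0 E (r i)).
- by move=> r; apply: dfn_bot.
- by move=> P Q _ hP _ hQ r; apply: dfn_imp.
move=> P _ hP r.
have := hP (fun n => if n is m.+1 then (r m).+1 else 0).
move/dfn_all0; apply: dfn_ext => s.
suff h x : P (scons x (fun n => s (r n))) =
  P (fun n => scons x s (if n is m.+1 then (r m).+1 else 0)).
  by split=> h' x; move: (h' x); rewrite h.
by congr P; apply/funext; case.
Qed.

Lemma dterm_var i : dterm E Y (fun s => s i).
Proof. exact: (dfn_eq0 _ _ i.+1 0). Qed.

Lemma dterm_cst c : dterm E Y (fun _ => c).
Proof. by apply: dfn_ext (dfn_cls0 E 0 (singY c)) => s; split=> ->. Qed.

Lemma dterm_ren (r : nat -> nat) t :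
  dterm E Y t -> dterm E Y (fun s => t (fun n => s (r n))).
Proof.
exact: (@dfn_ren (fun n => if n is m.+1 then (r m).+1 else 0)).
Qed.

Lemma dterm_shift t : dterm E Y t -> dterm E Y (fun s => t (fun n => s n.+1)).
Proof. exact: (@dterm_ren S). Qed.

(** A term is substituted by naming its value with an existential quantifier, since only its graph
    is definable. *)
Lemma dfn_unary A t : (forall i, dfn E Y (fun s => A (s i))) ->
  dterm E Y t -> dfn E Y (fun s => A (t s)).
Proof.
move=> dA dt; apply: dfn_ext (dfn_ex (P := fun s x => t s = x /\ A x) _) => [s|].
  by split=> [[x [<-]] | h] //; exists (t s).
by apply: dfn_and.
Qed.

Lemma dfn_binary A t u : (forall i j, dfn E Y (fun s => A (s i) (s j))) ->
  dterm E Y t -> dterm E Y u -> dfn E Y (fun s => A (t s) (u s)).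
Proof.
move=> dA dt du.
apply: dfn_ext (dfn_ex (P := fun s x => t s = x /\ A x (u s)) _) => [s|].
  by split=> [[x [<-]] | h] //; exists (t s).
apply: dfn_and => //.
pose P (s : nat -> M) y := u (fun n => s n.+1) = y /\ A (s 0) y.
apply: dfn_ext (dfn_ex (P := P) _) => [s|].
  by split=> [[x [<-]] | h] //; exists (u (fun n => s n.+1)).
by apply: dfn_and => //; exact: (dterm_shift du).
Qed.

Lemma dfn_mem t u : dterm E Y t -> dterm E Y u -> dfn E Y (fun s => E (t s) (u s)).
Proof. by apply: dfn_binary => i j; apply: dfn_mem0. Qed.

Lemma dfn_eq t u : dterm E Y t -> dterm E Y u -> dfn E Y (fun s => t s = u s).
Proof.
by apply: (@dfn_binary (fun x y => x = y)) => i j; apply: dfn_eq0.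
Qed.

Lemma dfn_cls A t : Y A -> dterm E Y t -> dfn E Y (fun s => A (t s)).
Proof. by move=> YA; apply: dfn_unary => i; apply: dfn_cls0. Qed.

(** Replacing all variables at once lets the induction pass under a quantifier: variable 0 stays
    bound there and every other term is shifted. *)
Lemma dfn_subst P (f : nat -> (nat -> M) -> M) : dfn E Y P ->
  (forall n, dterm E Y (f n)) -> dfn E Y (fun s => P (fun n => f n s)).
Proof.
move=> dP; elim: dP f => {P}.
- by move=> i j f df; apply: dfn_mem.
- by move=> i j f df; apply: dfn_eq.
- by move=> i A YA f df; apply: dfn_cls.
- by move=> f df; apply: dfn_bot.
- by move=> P Q _ hP _ hQ f df; apply: dfn_imp; [apply: hP|apply: hQ].
move=> P _ hP f df.
pose g n s := if n is m.+1 then f m (fun n => s n.+1) else s 0.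
have dg n : dterm E Y (g n).
  by case: n => [|n]; [exact: dterm_var|exact: (dterm_shift (df n))].
move: (dfn_all0 (hP g dg)); apply: dfn_ext => s.
suff h x : P (scons x (fun n => f n s)) = P (fun n => g n (scons x s)).
  by split=> h' x; move: (h' x); rewrite h.
by congr P; apply/funext; case.
Qed.

Lemma dpred1P (Q : M -> Prop) : dfn E Y (fun s => Q (s 0)) <-> dpred1 E Y Q.
Proof.
split=> [dQ t dt|]; last by apply; exact: dterm_var.
exact: (dfn_subst (f := fun n => t) dQ).
Qed.

Lemma dfun1P (F : M -> M) : dterm E Y (fun s => F (s 0)) <-> dfun1 E Y F.
Proof.
split=> [dF t dt|]; last by apply; exact: dterm_var.
pose f n s := if n is 0 then s 0 else t (fun n => s n.+1).
apply: (dfn_subst (f := f) dF) => -[|n]; first exact: dterm_var.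
exact: (dterm_shift dt).
Qed.

End Closure.

Lemma dfn_sub (M : Type) (E : M -> M -> Prop) (Y Z : set (set M)) P :
  Y `<=` Z -> dfn E Y P -> dfn E Z P.
Proof.
move=> YZ; elim=> {P}.
- exact: dfn_mem0.
- exact: dfn_eq0.
- by move=> i A /YZ; exact: dfn_cls0.
- exact: dfn_bot.
- by move=> P Q _ dP _; exact: dfn_imp.
- by move=> P _; exact: dfn_all0.
Qed.

(* Proof search for definability *)
Create HintDb dfn discriminated.
#[global] Hint Constants Opaque : dfn.
#[global] Hint Resolve dfn_not dfn_and dfn_and3 dfn_and4 dfn_and5 dfn_or
  dfn_or3 dfn_iff dfn_mem dfn_eq dfn_cls
  dterm_var dterm_cst : dfn.
#[global] Hint Extern 1 (dfn _ _ (fun s => forall _, _)) =>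
  first [apply: dfn_imp | apply: dfn_all] : dfn.
#[global] Hint Extern 1 (dfn _ _ (fun s => exists _, _)) => apply: dfn_ex : dfn.
#[global] Hint Extern 1 (dfn _ _ (fun s => exists2 _, _ & _)) =>
  apply: dfn_ex2 : dfn.
#[global] Hint Extern 2 (dterm _ _ (fun s => _ (fun n => s _))) =>
  lazymatch goal with |- dterm ?E ?Y (fun s => ?t (fun n => s (@?r n))) =>
    apply: (@dterm_ren _ E Y r t) end : dfn.
#[global] Hint Extern 2 (dfn _ _ (fun s => _ (fun n => s _))) =>
  lazymatch goal with |- dfn ?E ?Y (fun s => ?t (fun n => s (@?r n))) =>
    apply: (@dfn_ren _ E Y r t) end : dfn.
#[global] Hint Extern 9 (dfn _ _ _) => exact: dfn_const : dfn.

Ltac definable := cbv beta; typeclasses eauto with dfn.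

(** * Set operations *)

(** This is what forcing must preserve: over a model of [ZFC] it yields every axiom of [GBC] for the
    classes definable from [Y], except Global Choice. The functions replaced may be partial, so
    Separation is included. *)
Record model (M : Type) (E : M -> M -> Prop) (Y : set (set M)) : Prop := {
  model_sing : forall c, Y [set c];
  model_repl : forall P, dfn E Y P -> forall s a,
    (forall x y y', E x a -> P (scons x (scons y s)) ->
       P (scons x (scons y' s)) -> y = y') ->
    exists b, forall y, E y b <-> exists2 x, E x a & P (scons x (scons y s))
}.

Section Internal.
Variables (M : Type) (E : M -> M -> Prop) (hM : ZFC E).

Lemma ex_empty : exists e, forall z, ~ E z e.
Proof. by have [w [[e _ he] _]] := zfc_infinity hM; exists e. Qed.

Definition emp : M := projT1 (cid ex_empty).

Lemma empP z : ~ E z emp.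
Proof. exact: (projT2 (cid ex_empty)). Qed.

(* [cmp P] is the set {x | P x}, with junk value [emp] when {x | P x} is a
   proper class. *)
Definition cmp (P : M -> Prop) : M :=
  match pselect (exists b, forall x, E x b <-> P x) with
  | left h => projT1 (cid h)
  | right _ => emp
  end.

Lemma cmpP P : (exists b, forall x, E x b <-> P x) ->
  forall x, E x (cmp P) <-> P x.
Proof. by rewrite /cmp; case: pselect => // h _; exact: (projT2 (cid h)). Qed.

Lemma eext x y : (forall z, E z x <-> E z y) -> x = y.
Proof. exact: (zfc_extensionality hM). Qed.

Lemma cmpE P b : (forall x, E x b <-> P x) -> cmp P = b.
Proof.
by move=> h; apply: eext => z; rewrite cmpP ?h //; exists b.
Qed.

(** Definite description: the unique witness is rebuilt as the set of its own elements. Without a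
    unique witness the value is [emp]. *)
Definition mu (P : M -> Prop) : M :=
  cmp (fun z => exists y, [/\ P y, forall y', P y' -> y' = y & E z y]).

Lemma muE (P : M -> Prop) y : P y -> (forall y', P y' -> y' = y) -> mu P = y.
Proof.
move=> Py uy; apply: cmpE => z; split=> [zy|[y' [/uy-> //]]].
by exists y; split.
Qed.

Definition sub x y := forall z, E z x -> E z y.
Definition pr x y := cmp (fun z => z = x \/ z = y).
Definition opr x y := pr (pr x x) (pr x y).
Definition un a := cmp (fun x => exists2 y, E y a & E x y).
Definition pw a := cmp (fun x => sub x a).
Definition cup x y := un (pr x y).
Definition succ a := cup a (pr a a).
Definition img (F : M -> M) a := cmp (fun y => exists2 x, E x a & y = F x).
Definition ap f x := mu (fun y => E (opr x y) f).

Lemma prP x y z : E z (pr x y) <-> z = x \/ z = y.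
Proof. exact: (cmpP (zfc_pairing hM x y)). Qed.

Lemma unP a x : E x (un a) <-> exists2 y, E y a & E x y.
Proof. exact: (cmpP (zfc_union hM a)). Qed.

Lemma pwP a x : E x (pw a) <-> sub x a.
Proof. exact: (cmpP (zfc_powerset hM a)). Qed.

Lemma cupP x y z : E z (cup x y) <-> E z x \/ E z y.
Proof.
rewrite unP; split=> [[u /prP[->|->]]|[h|h]]; [by left|by right| |].
  by exists x => //; apply/prP; left.
by exists y => //; apply/prP; right.
Qed.

Lemma succP a z : E z (succ a) <-> E z a \/ z = a.
Proof. by rewrite cupP prP; split=> [[|[]]|[|]]; auto. Qed.

Lemma sub_trans x y z : sub x y -> sub y z -> sub x z.
Proof. by move=> h k w /h /k. Qed.

Lemma sub_un x a : E x a -> sub x (un a).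
Proof. by move=> xa z zx; apply/unP; exists x. Qed.

Lemma sing_inj x y z : pr x x = pr y z -> x = y /\ x = z.
Proof.
move=> h.
have : E y (pr x x) by rewrite h; apply/prP; left.
have : E z (pr x x) by rewrite h; apply/prP; right.
by move=> /prP[] -> /prP[] ->.
Qed.

Lemma opr_inj x y x' y' : opr x y = opr x' y' -> x = x' /\ y = y'.
Proof.
move=> h.
have xx' : x = x'.
  have : E (pr x x) (opr x' y') by rewrite -h; apply/prP; left.
  by move=> /prP[] /sing_inj[].
subst x'; split=> //.
have : E (pr x y) (opr x y') by rewrite -h; apply/prP; right.
have : E (pr x y') (opr x y) by rewrite h; apply/prP; right.
move=> /prP[/esym/sing_inj[_ xy']|].
  by move=> /prP[/esym/sing_inj[]|/esym]; rewrite -xy' // => /sing_inj[_ ->].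
move=> e _.
have : E y (pr x y') by rewrite e; apply/prP; right.
move=> /prP[yx|//]; subst y.
by move/esym: e => /sing_inj[].
Qed.

Lemma is_oprP p x y : is_opair E p x y <-> p = opr x y.
Proof.
have upr u a b : is_upair E u a b <-> u = pr a b.
  split=> [h|-> z]; last exact: prP.
  by apply: eext => z; rewrite h prP.
split=> [[u [v [/upr-> /upr-> /upr->]]] //|->].
by exists (pr x x), (pr x y); split; apply/upr.
Qed.

Lemma maps_toP (F : set M) x y : maps_to E F x y <-> F (opr x y).
Proof.
split=> [[p Fp /is_oprP <-]//|h].
by exists (opr x y) => //; apply/is_oprP.
Qed.

Lemma found b : (exists x, E x b) ->
  exists2 m, E m b & forall z, E z m -> ~ E z b.
Proof.
move=> /(zfc_foundation hM)[m mb h]; exists m => // z zm zb.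
by apply: h; exists z.
Qed.

Lemma irr x : ~ E x x.
Proof.
move=> xx; have [|m /prP[->|->] /(_ x xx)] := @found (pr x x).
- by exists x; apply/prP; left.
- by apply; apply/prP; left.
- by apply; apply/prP; left.
Qed.

Lemma acyc2 x y : E x y -> ~ E y x.
Proof.
move=> xy yx; have [|m /prP[->|->]] := @found (pr x y).
- by exists x; apply/prP; left.
- by move/(_ y yx); apply; apply/prP; right.
- by move/(_ x xy); apply; apply/prP; left.
Qed.

Lemma acyc3 x y z : E x y -> E y z -> ~ E z x.
Proof.
move=> xy yz zx.
have [|m /cupP[/prP[->|->]|/prP[->|->]]] := @found (cup (pr x y) (pr z z)).
- by exists x; apply/cupP; left; apply/prP; left.
- by move/(_ z zx); apply; apply/cupP; right; apply/prP; right.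
- by move/(_ x xy); apply; apply/cupP; left; apply/prP; left.
- by move/(_ y yz); apply; apply/cupP; left; apply/prP; right.
- by move/(_ y yz); apply; apply/cupP; left; apply/prP; right.
Qed.

Section Definable.
Variables (Y : set (set M)).
Hypothesis singY : forall c, Y [set c].

(** The graph splits in two definable cases: the value has exactly the required elements, or no set
    has them and the value is the parameter [emp]. *)
Lemma dterm_cmp (P : (nat -> M) -> M -> Prop) :
  dfn E Y (fun s => P (fun n => s n.+1) (s 0)) ->
  dterm E Y (fun s => cmp (P s)).
Proof.
move=> dP.
have dP' : dfn E Y (fun s => P (fun n => s n.+2) (s 0)).
  exact: (dfn_ren (fun n => if n is m.+1 then m.+2 else 0) dP).
have d : dfn E Y (fun s => (forall x, E x (s 0) <-> P (fun n => s n.+1) x) \/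
  (~ (exists b, forall x, E x b <-> P (fun n => s n.+1) x) /\ s 0 = emp)).
  have dP'' : dfn E Y (fun s => P (fun n => s n.+3) (s 0)).
    exact: (dfn_ren (fun n => if n is m.+1 then m.+3 else 0) dP).
  definable.
apply: dfn_ext d => s; split=> [[/cmpE //|[h ->]]|<-].
  by rewrite /cmp; case: pselect.
have [h|h] := pselect (exists b, forall x, E x b <-> P (fun n => s n.+1) x).
  by left=> x; rewrite cmpP.
by right; split => //; rewrite /cmp; case: pselect.
Qed.

End Definable.
End Internal.

#[global] Hint Extern 1 (dterm _ _ (fun s => cmp _ _)) =>
  apply: dterm_cmp : dfn.
#[global] Hint Extern 1 (dfn _ _ (fun s => sub _ _ _)) =>
  rewrite /sub : dfn.

Section Operations.
Variables (M : Type) (E : M -> M -> Prop) (hM : ZFC E).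
Variables (Y : set (set M)).
Hypothesis singY : forall c, Y [set c].

Lemma dterm_mu (P : (nat -> M) -> M -> Prop) :
  dfn E Y (fun s => P (fun n => s n.+1) (s 0)) ->
  dterm E Y (fun s => mu hM (P s)).
Proof.
move=> dP.
have dP' : dfn E Y (fun s => P (fun n => s n.+2) (s 0)).
  exact: (dfn_ren (fun n => if n is m.+1 then m.+2 else 0) dP).
have dP'' : dfn E Y (fun s => P (fun n => s n.+3) (s 0)).
  exact: (dfn_ren (fun n => if n is m.+1 then m.+3 else 0) dP).
rewrite /mu; definable.
Qed.

Lemma dterm_img (F : (nat -> M) -> M -> M) t :
  dterm E Y (fun s => F (fun n => s n.+1) (s 0)) -> dterm E Y t ->
  dterm E Y (fun s => img hM (F s) (t s)).
Proof.
move=> dF dt; rewrite /img.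
have dF' : dterm E Y (fun s => F (fun n => s n.+2) (s 0)).
  exact: (dterm_ren (fun n => if n is m.+1 then m.+2 else 0) dF).
definable.
Qed.

Lemma dterm_pr : dfun2 E Y (pr hM).
Proof. move=> t u dt du; rewrite /pr; definable. Qed.

Lemma dterm_un : dfun1 E Y (un hM).
Proof. move=> t dt; rewrite /un; definable. Qed.

Lemma dterm_pw : dfun1 E Y (pw hM).
Proof. move=> t dt; rewrite /pw; definable. Qed.
End Operations.

#[global] Hint Extern 1 (dterm _ _ (fun s => mu _ _)) =>
  apply: dterm_mu : dfn.
#[global] Hint Extern 1 (dterm _ _ (fun s => img _ _ _)) =>
  apply: dterm_img : dfn.
#[global] Hint Resolve dterm_pr dterm_un dterm_pw : dfn.

Section Operations2.
Variables (M : Type) (E : M -> M -> Prop) (hM : ZFC E).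
Variables (Y : set (set M)).
Hypothesis singY : forall c, Y [set c].

Lemma dterm_opr : dfun2 E Y (opr hM).
Proof. move=> t u dt du; rewrite /opr; definable. Qed.

Lemma dterm_cup : dfun2 E Y (cup hM).
Proof. move=> t u dt du; rewrite /cup; definable. Qed.

Lemma dterm_succ : dfun1 E Y (succ hM).
Proof. move=> t dt; rewrite /succ /cup; definable. Qed.
End Operations2.
#[global] Hint Resolve dterm_opr dterm_cup dterm_succ : dfn.

Lemma dterm_ap M (E : M -> M -> Prop) (hM : ZFC E) (Y : set (set M))
  (singY : forall c, Y [set c]) : dfun2 E Y (ap hM).
Proof. move=> t u dt du; rewrite /ap; definable. Qed.

Lemma dfn_ord M (E : M -> M -> Prop) Y : dpred1 E Y (is_ordinal E).
Proof. move=> t dt; rewrite /is_ordinal; definable. Qed.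
#[global] Hint Resolve dterm_ap dfn_ord : dfn.

(** * Ordinals *)

Section Ordinals.
Variables (M : Type) (E : M -> M -> Prop) (hM : ZFC E).
Variables (Y : set (set M)) (hY : model E Y).
Let singY : forall c, Y [set c] := model_sing hY.
Local Notation cmp := (cmp hM).
Local Notation mu := (mu hM).
Local Notation emp := (emp hM).
Local Notation sub := (sub E).
Local Notation un := (un hM).
Local Notation succ := (succ hM).
Local Notation img := (img hM).
Local Notation Ord := (is_ordinal E).

(** Separation is replacement for the identity function restricted to [Q]. *)
Lemma sepP (Q : M -> Prop) a : dfn E Y (fun s => Q (s 0)) ->
  (forall x, Q x -> E x a) -> forall x, E x (cmp Q) <-> Q x.
Proof.
move=> dQ Qa; apply: cmpP.
have d : dfn E Y (fun s => s 0 = s 1 /\ Q (s 0)) by definable.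
have [|b hb] := @model_repl _ _ _ hY _ d (fun _ => a) a.
  by move=> x y y' _ /= [<- _] [<- _].
exists b => x; rewrite hb /=; split=> [[y _ [<-]] //|Qx].
by exists x; [apply: Qa|split].
Qed.

Lemma sepI a (Q : M -> Prop) : dfn E Y (fun s => Q (s 0)) ->
  forall x, E x (cmp (fun x => E x a /\ Q x)) <-> E x a /\ Q x.
Proof. by move=> dQ; apply: (@sepP _ a) => [|x []//]; definable. Qed.

Lemma imgP (F : M -> M) a : dterm E Y (fun s => F (s 0)) ->
  forall y, E y (img F a) <-> exists2 x, E x a & y = F x.
Proof.
move=> /dfun1P dF; apply: cmpP.
have d : dfn E Y (fun s => s 1 = F (s 0)) by definable.
have [|b hb] := @model_repl _ _ _ hY _ d (fun _ => a) a.
  by move=> x y y' _ /= -> ->.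
by exists b => y; rewrite hb.
Qed.

Lemma ord_tr a x y : Ord a -> E x a -> E y x -> E y a.
Proof. by move=> [h _ _ _ _]; exact: h. Qed.

(** The remaining clauses come from Foundation, which excludes membership cycles of length at most
    three and provides minimal elements. *)
Lemma ordI a : (forall x y, E x a -> E y x -> E y a) ->
  (forall x y, E x a -> E y a -> [\/ E x y, x = y | E y x]) -> Ord a.
Proof.
move=> tr tot; split=> // [x _|x y z xa ya za xy yz|b ba].
- exact: irr.
- have [//|xz|zx] := tot x z xa za.
    by subst z; case: (acyc2 hM xy yz).
  by case: (acyc3 hM xy yz zx).
move=> /(found hM)[m mb hm]; exists m => // x xb.
have [|<-|] := tot x m (ba _ xb) (ba _ mb); [|by left|by right].
by move=> /hm.
Qed.

Lemma ord_mem a x : Ord a -> E x a -> Ord x.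
Proof.
move=> oa xa; have [tr _ tr3 tot _] := oa; apply: ordI => y z.
  move=> yx zy; have ya := tr _ _ xa yx.
  exact: (tr3 _ _ _ (tr _ _ ya zy) ya).
by move=> yx zx; apply: tot; apply: (tr _ _ xa).
Qed.

(** If [b] has elements outside [a], the least of them is [a] itself. *)
Lemma ord_sub a b : Ord a -> Ord b -> sub a b -> a = b \/ E a b.
Proof.
move=> oa ob ab; have [[x [xb xa]]|h] := pselect (exists x, E x b /\ ~ E x a).
  right; have hc := @sepI b (fun x => ~ E x a) ltac:(definable).
  have [|m /hc[mb ma] hm] := found hM (b := cmp (fun x => E x b /\ ~ E x a)).
    by exists x; apply/hc.
  suff -> : a = m by [].
  apply: (eext hM) => z; split=> [za|zm].
    have [_ _ _ tot _] := ob.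
    have [//|zm|mz] := tot z m (ab _ za) mb; first by subst z.
    by case: ma; apply: ord_tr za mz.
  apply: contrapT => za; apply: (hm z zm); apply/hc; split=> //.
  exact: ord_tr mb zm.
left; apply: (eext hM) => z; split; first exact: ab.
by move=> zb; apply: contrapT => za; apply: h; exists z.
Qed.

(** The intersection of [a] and [b] is an ordinal included in both; if it differed from both, it
    would be an element of both and hence of itself. *)
Lemma ord_cmp a b : Ord a -> Ord b -> [\/ E a b, a = b | E b a].
Proof.
move=> oa ob.
have hc := @sepI a (fun x => E x b) ltac:(definable).
set c := cmp _ in hc.
have oc : Ord c.
  apply: ordI => x y.
    by move=> /hc[xa xb] yx; apply/hc; split; [apply: ord_tr xa yx|apply: ord_tr xb yx].
  by move=> /hc[xa _] /hc[ya _]; have [_ _ _ tot _] := oa; apply: tot.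
have [ca|ca] : c = a \/ E c a by apply: ord_sub => // x /hc[].
  have [cb|cb] : c = b \/ E c b by apply: ord_sub => // x /hc[].
    by apply: Or32; rewrite -ca.
  by apply: Or31; rewrite -ca.
have [cb|cb] : c = b \/ E c b by apply: ord_sub => // x /hc[].
  by apply: Or33; rewrite -cb.
by case: (irr hM (x := c)); apply/hc.
Qed.

Lemma ord_ind (Q : M -> Prop) : dfn E Y (fun s => Q (s 0)) ->
  (forall a, Ord a -> (forall b, E b a -> Q b) -> Q a) -> forall a, Ord a -> Q a.
Proof.
move=> dQ ind a oa; apply: contrapT => nQa.
have hc := @sepI (succ a) (fun x => ~ Q x) ltac:(definable).
have [|m /hc[ma nm] hm] := found hM (b := cmp (fun x => E x (succ a) /\ ~ Q x)).
  by exists a; apply/hc; split => //; apply/succP; right.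
have om : Ord m by case/succP: (ma) => [|->//]; exact: ord_mem.
apply: nm; apply: ind => // b bm; apply: contrapT => nb; apply: (hm b bm).
apply/hc; split=> //; apply/succP; left.
by case/succP: ma => [ma|<- //]; apply: (ord_tr oa ma bm).
Qed.

Definition leasto (Q : M -> Prop) : M :=
  mu (fun a => [/\ Ord a, Q a & forall b, E b a -> ~ Q b]).

Lemma leastoP (Q : M -> Prop) : dfn E Y (fun s => Q (s 0)) ->
  (exists2 a, Ord a & Q a) ->
  [/\ Ord (leasto Q), Q (leasto Q) & forall b, E b (leasto Q) -> ~ Q b].
Proof.
move=> dQ [a oa Qa].
have [m [om Qm hm]] : exists m, [/\ Ord m, Q m & forall b, E b m -> ~ Q b].
  apply: contrapT => h; move: a oa Qa.
  apply: ord_ind; first exact: dfn_not.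
  by move=> a oa ha Qa; apply: h; exists a.
suff -> : leasto Q = m by [].
apply: muE => // m' [om' Qm' hm'].
by have [/hm|//|/hm'] := ord_cmp om' om.
Qed.

Lemma ord_emp : Ord emp.
Proof. by apply: ordI => x y h; case: (empP h). Qed.

Lemma ord_succ a : Ord a -> Ord (succ a).
Proof.
move=> oa; apply: ordI => x y.
  move=> /succP[xa yx|->]; first by apply/succP; left; apply: ord_tr xa yx.
  by move=> ya; apply/succP; left.
have os z : E z (succ a) -> Ord z by case/succP => [|->//]; exact: ord_mem.
by move=> /os ox /os oy; exact: ord_cmp.
Qed.

Lemma succ_mem a : E a (succ a).
Proof. by apply/succP; right. Qed.

Lemma ord_un c : (forall x, E x c -> Ord x) -> Ord (un c).
Proof.
move=> oc; have ou x : E x (un c) -> Ord x.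
  by move=> /unP[y /oc]; exact: ord_mem.
apply: ordI => x y; last by move=> /ou ox /ou oy; exact: ord_cmp.
move=> /unP[z zc xz] yx; apply/unP; exists z => //.
exact: ord_tr (oc _ zc) xz yx.
Qed.

Lemma ord_bound c : (forall x, E x c -> Ord x) ->
  exists2 a, Ord a & forall x, E x c -> E x a.
Proof.
move=> oc; exists (succ (un c)); first exact/ord_succ/ord_un.
move=> x xc; apply/succP; have [| |h|->|h] := @ord_cmp x (un c).
- exact: oc.
- exact: ord_un.
- by left.
- by right.
- by case: (irr hM (x := un c)); apply/unP; exists x.
Qed.

(** Burali-Forti: Separation would cut [c] down to the set of all ordinals, and an ordinal bounding
    its elements would belong to itself. *)
Lemma ord_proper c : ~ forall x, Ord x -> E x c.
Proof.
move=> h; have hc := @sepI c Ord ltac:(definable).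
have [a oa ha] := ord_bound (fun x => fun h => proj2 (proj1 (hc x) h)).
by apply: (irr hM (x := a)); apply: ha; apply/hc; split=> //; apply: h.
Qed.

Lemma ord_img_bound F a : dterm E Y (fun s => F (s 0)) ->
  (forall x, E x a -> Ord (F x)) ->
  exists2 b, Ord b & forall x, E x a -> E (F x) b.
Proof.
move=> dF oF; have [|b ob hb] := @ord_bound (img F a).
  by move=> x /(imgP _ dF)[y /oF oy ->].
by exists b => // x xa; apply: hb; apply/(imgP _ dF); exists x.
Qed.

End Ordinals.

Lemma dterm_leasto M (E : M -> M -> Prop) (hM : ZFC E) (Y : set (set M))
  (singY : forall c, Y [set c]) (P : (nat -> M) -> M -> Prop) :
  dfn E Y (fun s => P (fun n => s n.+1) (s 0)) ->
  dterm E Y (fun s => leasto hM (P s)).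
Proof.
move=> dP.
have dP' : dfn E Y (fun s => P (fun n => s n.+2) (s 0)).
  exact: (dfn_ren (fun n => if n is m.+1 then m.+2 else 0) dP).
rewrite /leasto; definable.
Qed.
#[global] Hint Extern 1 (dterm _ _ (fun s => leasto _ _)) =>
  apply: dterm_leasto : dfn.

(** * Recursion, choice and distributivity *)

Section Recursion.
Variables (M : Type) (E : M -> M -> Prop) (hM : ZFC E).
Variables (Y : set (set M)) (hY : model E Y).
Let singY : forall c, Y [set c] := model_sing hY.
Local Notation cmp := (cmp hM).
Local Notation mu := (mu hM).
Local Notation emp := (emp hM).
Local Notation sub := (sub E).
Local Notation pr := (pr hM).
Local Notation opr := (opr hM).
Local Notation un := (un hM).
Local Notation pw := (pw hM).
Local Notation cup := (cup hM).
Local Notation succ := (succ hM).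
Local Notation img := (img hM).
Local Notation ap := (ap hM).
Local Notation Ord := (is_ordinal E).
Local Notation leasto := (leasto hM).

Lemma img_ext F G a : (forall x, E x a -> F x = G x) -> img F a = img G a.
Proof.
move=> FG; congr cmp; apply/funext => y; apply/propext.
by split=> -[x xa ->]; exists x => //; rewrite FG.
Qed.

Section RecursionEquation.
Variables (H : M -> M -> M) (dH : dfun2 E Y H).

(** An attempt is a set coding a function that obeys the recursion below [a]. Attempts agree with
    each other, so [rec a] can be read off any of them, and replacement collects the earlier values
    of [rec] into an attempt. *)
Let att a f := forall b, E b a -> ap f b = H b (img (ap f) b).
Let rec a := mu (fun y => exists2 f, att a f & y = H a (img (ap f) a)).

Let drec : dfun1 E Y rec.
Proof. by move=> t dt; rewrite /rec /att; definable. Qed.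

Let att_uniq a f g : Ord a -> att a f -> att a g ->
  forall b, E b a -> ap f b = ap g b.
Proof.
move=> oa hf hg b ba.
suff : E b a -> ap f b = ap g b by apply.
move: b {ba} (ord_mem hM oa ba).
apply: (ord_ind hM hY); first by definable.
move=> b ob ih ba; rewrite hf // hg //; congr H; apply: img_ext => c cb.
by apply: ih => //; apply: ord_tr ba cb.
Qed.

Let recE a f : Ord a -> att a f -> rec a = H a (img (ap f) a).
Proof.
move=> oa hf; apply: muE; first by exists f.
move=> _ [g hg ->]; congr H; apply: img_ext => b ba.
exact: att_uniq oa hg hf _ ba.
Qed.

Let rec_att a f b : Ord a -> att a f -> E b a -> rec b = ap f b.
Proof.
move=> oa hf ba; rewrite (@recE b f); [by rewrite -hf| exact: ord_mem ba|].
by move=> c cb; apply: hf; apply: ord_tr ba cb.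
Qed.

Let ex_att a : Ord a -> exists f, att a f.
Proof.
move: a; apply: (ord_ind hM hY); first by rewrite /att; definable.
move=> a oa ih; pose f := img (fun b => opr b (rec b)) a.
have fP p : E p f <-> exists2 b, E b a & p = opr b (rec b).
  by rewrite /f (imgP hM hY) //; definable.
have apf b : E b a -> ap f b = rec b.
  move=> ba; apply: muE; first by apply/fP; exists b.
  by move=> y /fP[c _ /(@opr_inj _ _ hM)[-> ->]].
exists f => b ba; have [g hg] := ih b ba; have ob := ord_mem hM oa ba.
rewrite apf // (recE ob hg); congr H; apply: img_ext => c cb.
by rewrite apf ?(rec_att ob hg) //; apply: ord_tr ba cb.
Qed.

(** The step function receives the index and the set of earlier values, not the function on earlier
    indices; all recursions below can be cast in this form. *)
Lemma ord_rec : exists2 F, dfun1 E Y F & forall a, Ord a -> F a = H a (img F a).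
Proof.
exists rec => // a oa; have [f hf] := ex_att oa.
rewrite (recE oa hf); congr H; apply: img_ext => b ba.
by rewrite (rec_att oa hf).
Qed.

End RecursionEquation.

(** Otherwise every nonzero ordinal is a successor, and by induction all ordinals lie in the
    inductive set given by Infinity, against [ord_proper]. *)
Lemma limit_ord : exists l, [/\ Ord l, E emp l & forall a, E a l -> E (succ a) l].
Proof.
apply: contrapT => h; have [w [[e ew he] sw]] := zfc_infinity hM.
apply: (@ord_proper _ _ hM _ hY w); apply: (ord_ind hM hY); first by definable.
move=> a oa ih; have [ae|ea] : a = emp \/ E emp a.
  have [aa|->|] := ord_cmp hM hY oa (ord_emp hM); [|by left|by right].
  by case: (empP aa).
  suff -> : a = e by [].
  by apply: (eext hM) => z; split=> [|/he //]; rewrite ae => k; case: (empP k).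
have [b [ba nb]] : exists b, E b a /\ ~ E (succ b) a.
  apply: contrapT => k; apply: h; exists a; split=> // b ba.
  by apply: contrapT => nb; apply: k; exists b.
have [y yw hy] := sw b (ih b ba).
suff -> : a = y by [].
transitivity (succ b); last by apply: (eext hM) => z; rewrite hy; apply: succP.
have [ab|//|//] := ord_cmp hM hY oa (ord_succ hM hY (ord_mem hM oa ba)).
case/succP: ab => [ab|ab]; first by case: (acyc2 hM ab ba).
by case: (irr hM (x := b)); rewrite ab in ba.
Qed.

(** Stage [a] of the recursion collects [x], all earlier stages and all their unions. At a limit
    [l], an element of an element of [F l] appears one successor step later, still below [l]. *)
Lemma trans_closure x : exists2 t, sub x t & forall y z, E y t -> E z y -> E z t.
Proof.
pose H (a r : M) := cup x (cup (un r) (un (un r))).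
have [|F dF hF] := @ord_rec H; first by rewrite /H; definable.
have [l [ol l0 ls]] := limit_ord.
have FP a : Ord a -> forall y, E y (F a) <-> E y x \/
    exists2 b, E b a & E y (F b) \/ exists2 z, E z (F b) & E y z.
  move=> oa y; rewrite hF // /H !cupP !unP.
  have iP z : E z (img F a) <-> exists2 b, E b a & z = F b.
    by rewrite (imgP hM hY) //; definable.
  split=> [[|[[_ /iP[b ba ->]]|[z /unP[_ /iP[b ba ->]]]]]|[|[b ba [|[z]]]]].
  - by left.
  - by right; exists b => //; left.
  - by move=> zb yz; right; exists b => //; right; exists z.
  - by left.
  - by right; left; exists (F b) => //; apply/iP; exists b.
  - move=> zb yz; right; right; exists z => //; apply/unP.
    by exists (F b) => //; apply/iP; exists b.
have ol' b : E b l -> Ord b by exact: ord_mem.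
exists (F l) => [y yx|y z yl zy]; first by apply/FP => //; left.
apply/FP => //; right; case/(FP _ ol): yl => [yx|[b bl [yb|[u ub yu]]]].
- exists emp => //; right; exists y => //; apply/FP; first exact: ol'.
  by left.
- by exists b => //; right; exists y.
- exists (succ b); first exact: ls.
  right; exists y => //; apply/FP; first by apply/ol'/ls.
  by right; exists b; [apply: succ_mem|right; exists u].
Qed.

(** Foundation speaks of sets, so the counterexamples are first confined to a transitive set
    including [x]. *)
Lemma mem_ind (Q : M -> Prop) : dfn E Y (fun s => Q (s 0)) ->
  (forall x, (forall y, E y x -> Q y) -> Q x) -> forall x, Q x.
Proof.
move=> dQ ind x; have [t xt tt] := trans_closure x.
apply: (ind) => y0 yx0; apply: contrapT => nQ.
have hc := @sepI _ _ hM _ hY t (fun x => ~ Q x) ltac:(definable).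
have [|m /hc[mt nm] hm] := found hM (b := cmp (fun y => E y t /\ ~ Q y)).
  by exists y0; apply/hc; split=> //; apply: xt.
apply: nm; apply: ind => y ym; apply: contrapT => ny.
by apply: (hm y ym); apply/hc; split=> //; apply: tt mt ym.
Qed.

(** [V a] is the union of the power sets of the [V b] with [b] below [a]. By membership induction
    every set is reached: the ranks of its elements are bounded by replacement. *)
Lemma cumulative_hierarchy : exists V, [/\ dfun1 E Y V,
  forall a b, Ord a -> E b a -> sub (V b) (V a) &
  forall x, exists2 a, Ord a & E x (V a)].
Proof.
pose H (a r : M) := un (img pw r).
have [|V dV hV] := @ord_rec H; first by rewrite /H; definable.
have VP a x : Ord a -> E x (V a) <-> exists2 b, E b a & sub x (V b).
  move=> oa; rewrite hV // /H unP.
  have iP z : E z (img V a) <-> exists2 b, E b a & z = V b.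
    by rewrite (imgP hM hY) //; definable.
  have jP z : E z (img pw (img V a)) <-> exists2 b, E b (img V a) & z = pw b.
    by rewrite (imgP hM hY) //; definable.
  split=> [[_ /jP[_ /iP[b ba ->] ->] /pwP xb]|[b ba xb]]; first by exists b.
  by exists (pw (V b)); [apply/jP; exists (V b) => //; apply/iP; exists b|apply/pwP].
have mono a b : Ord a -> E b a -> sub (V b) (V a).
  move=> oa ba x /(VP _ _ (ord_mem hM oa ba))[c cb xc]; apply/VP => //.
  by exists c => //; apply: ord_tr ba cb.
exists V; split=> //; apply: mem_ind => [|x ih]; first by definable.
pose r y := leasto (fun a => E y (V a)).
have rP y : E y x -> Ord (r y) /\ E y (V (r y)).
  by move=> /ih h; have [] := leastoP hM hY (Q := fun a => E y (V a)) _ h; [definable|].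
have [||b ob hb] := @ord_img_bound _ _ hM _ hY r x.
- by rewrite /r; definable.
- by move=> y /rP[].
exists (succ b); first exact: (ord_succ hM hY).
apply/VP; first exact: (ord_succ hM hY).
exists b; first exact: succ_mem.
by move=> y yx; apply: (mono _ _ ob (hb y yx)); have [] := rP y yx.
Qed.

(** The axiom of choice is stated for disjoint families, so each [b] is replaced by its tagged copy
    [G b], the product of the singleton of [b] with [b]. *)
Lemma choice_function T : exists2 ch, dfun1 E Y ch &
  forall b, sub b T -> (exists x, E x b) -> E (ch b) b.
Proof.
pose G b := img (opr b) b.
have GP b z : E z (G b) <-> exists2 x, E x b & z = opr b x.
  by rewrite /G (imgP hM hY) //; definable.
have hc := @sepI _ _ hM _ hY (pw T) (fun b => exists x, E x b) ltac:(definable).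
set c0 := cmp _ in hc.
have AP z : E z (img G c0) <-> exists2 b, E b c0 & z = G b.
  by rewrite (imgP hM hY) // /G; definable.
have [||c cP] := zfc_choice hM (a := img G c0).
- move=> _ /AP[b /hc[_ [x xb]] ->]; exists (opr b x).
  by apply/GP; exists x.
- move=> _ _ z /AP[b _ ->] /AP[b' _ ->] /GP[x _ ->] /GP[x' _].
  by move=> /(@opr_inj _ _ hM)[-> _].
exists (fun b => mu (fun x => E x b /\ E (opr b x) c)); first by move=> t dt; definable.
move=> b bT nb; have [] := cP (G b).
  by apply/AP; exists b => //; apply/hc; split=> //; apply/pwP.
move=> z [[/GP[x xb ->] xc] uz].
suff -> : mu (fun x => E x b /\ E (opr b x) c) = x by [].
apply: muE => // x' [x'b x'c].
have bx' : E (opr b x') (G b) by apply/GP; exists x'.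
by have /(@opr_inj _ _ hM)[_ ->] := uz _ (conj bx' x'c).
Qed.

(** Zermelo's argument: keep choosing an element of [T] not listed yet. If [T] were never exhausted,
    [g] would inject the ordinals into [T], and the image of [T] under its inverse would contain
    every ordinal. *)
Lemma well_order_set T : exists k g, [/\ Ord k, dfun1 E Y g &
  forall x, E x T -> exists2 a, E a k & g a = x].
Proof.
have [ch dch chP] := choice_function T.
pose H (a r : M) := ch (cmp (fun x => E x T /\ ~ E x r)).
have [|g dg hg] := @ord_rec H; first by rewrite /H; definable.
have iP a x : E x (img g a) <-> exists2 b, E b a & x = g b.
  by rewrite (imgP hM hY) //; definable.
apply: contrapT => h.
have gP a : Ord a -> E (g a) T /\ ~ E (g a) (img g a).
  move=> oa; have hc := @sepI _ _ hM _ hY T (fun x => ~ E x (img g a)) ltac:(definable).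
  have : E (H a (img g a)) (cmp (fun x => E x T /\ ~ E x (img g a))).
    apply: chP => [x /hc[]//|]; apply: contrapT => nx; apply: h; exists a, g.
    split=> // x xT; apply: contrapT => xa; apply: nx; exists x; apply/hc; split=> //.
    by move=> /iP[b ba e]; apply: xa; exists b.
  by rewrite -hg // => /hc.
have ginj a b : Ord a -> Ord b -> g a = g b -> a = b.
  move=> oa ob e; have [ab|//|ba] := ord_cmp hM hY oa ob.
    by case: (gP b ob) => _; case; apply/iP; exists a.
  by case: (gP a oa) => _; case; apply/iP; exists b.
pose f x := mu (fun a => Ord a /\ g a = x).
have fP y : E y (img f T) <-> exists2 x, E x T & y = f x.
  by rewrite (imgP hM hY) // /f; definable.
apply: (@ord_proper _ _ hM _ hY (img f T)) => a oa; apply/fP; exists (g a).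
  by have [] := gP a oa.
by apply/esym/muE => // b [ob e]; apply: ginj.
Qed.

(* No global choice is assumed, so the conditions met along the way are first
   confined to a set, on which there is a choice function. *)
Lemma distributive (Cond : M -> Prop) (D : M -> M -> Prop) (a p : M) :
  dpred1 E Y Cond -> dpred2 E Y D ->
  (forall c, (forall q, E q c -> Cond q) ->
     (forall q r, E q c -> E r c -> sub q r \/ sub r q) -> Cond (un c)) ->
  (forall x q r, Cond r -> sub q r -> D x q -> D x r) ->
  (forall x q, E x a -> Cond q -> exists r, [/\ Cond r, sub q r & D x r]) ->
  Cond p -> exists q, [/\ Cond q, sub p q & forall x, E x a -> D x q].
Proof.
move=> dC dD chain Dopen Ddense Cp.
have [k [g [ok dg gP]]] := well_order_set a.
have [V [dV Vmono Vcov]] := cumulative_hierarchy.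
(* Adding [p] makes the union an extension of [p] even when the chain [c] is empty. *)
pose lb c := un (cup c (pr p p)).
pose good c := (forall q, E q c -> Cond q /\ sub p q) /\
  (forall q r, E q c -> E r c -> sub q r \/ sub r q).
have lbP c : good c -> [/\ Cond (lb c), sub p (lb c) &
    forall q, E q c -> sub q (lb c)].
  move=> [cC cch]; have in' q : E q (cup c (pr p p)) <-> E q c \/ q = p.
    by rewrite cupP prP; split=> [[|[]]|[|]]; auto.
  split=> [||q qc]; last 2 first.
  - by apply: sub_un; apply/in'; right.
  - by apply: sub_un; apply/in'; left.
  apply: chain => [q /in'[/cC[]//|-> //]|q r /in'[qc|->] /in'[rc|->]].
  - exact: cch.
  - by right; case: (cC q qc).
  - by left; case: (cC r rc).
  - by left.
(* The enumeration [g] may leave [a]; at such indices nothing has to be met. *)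
pose next al c q := Cond q /\ (sub (lb c) q /\ (E (g al) a -> D (g al) q)).
have nextP al c : good c -> exists q, next al c q.
  move=> /lbP[Cl _ _]; have [ga|nga] := pselect (E (g al) a).
    by have [q [Cq lq Dq]] := Ddense _ _ ga Cl; exists q.
  by exists (lb c); split=> //; split=> // /nga.
have dgood : dpred1 E Y good by move=> t dt; rewrite /good; definable.
have dlb : dfun1 E Y lb by move=> t dt; rewrite /lb; definable.
have dnext t u v : dterm E Y t -> dterm E Y u -> dterm E Y v ->
    dfn E Y (fun s => next (t s) (u s) (v s)).
  by move=> *; rewrite /next; definable.
(* Stage [th] of the hierarchy is high enough to contain a next condition for every chain formed
   from the elements of the members of [r]. *)
pose st al r th := forall c, sub c (un r) -> good c ->
  exists2 q, E q (V th) & next al c q.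
have dst t u v : dterm E Y t -> dterm E Y u -> dterm E Y v ->
    dfn E Y (fun s => st (t s) (u s) (v s)).
  by move=> *; rewrite /st; definable.
have stP al r : st al r (leasto (st al r)).
  pose Q c b := exists2 q, E q (V b) & good c -> next al c q.
  have dQ : dpred2 E Y Q by move=> t u dt du; rewrite /Q; definable.
  have Qex c : exists2 b, Ord b & Q c b.
    have [/(nextP al)[q nq]|ngc] := pselect (good c).
      by have [b ob qb] := Vcov q; exists b => //; exists q.
    by have [b ob pb] := Vcov p; exists b => //; exists p.
  have rkP c := leastoP hM hY (Q := Q c) ltac:(definable) (Qex c).
  have [||b ob hb] := @ord_img_bound _ _ hM _ hY (fun c => leasto (Q c)) (pw (un r)).
  - by definable.
  - by move=> c _; have [] := rkP c.
  have [||//] := leastoP hM hY (Q := st al r); first by definable.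
  exists b => // c cr gc; have [oc [q qc /(_ gc) nq] _] := rkP c.
  by exists q => //; apply: (Vmono _ _ ob (hb c _)) => //; apply/pwP.
(* First recursion: sets [T al] large enough to hold the condition chosen at step [al], whatever
   choices were made before. *)
have [|T dT hT] := @ord_rec (fun al r => V (leasto (st al r))); first by definable.
have [ch dch chP] := choice_function (un (img T k)).
pose cand al r := cmp (fun q => E q (T al) /\ next al r q).
(* Second recursion: the conditions themselves, all picked by the single choice function on the
   union of the [T al]. *)
have [|F dF hF] := @ord_rec (fun al r => ch (cand al r)).
  by rewrite /cand; definable.
have iP G al z : dfun1 E Y G ->
    E z (img G al) <-> exists2 b, E b al & z = G b.
  by move=> dG; rewrite (imgP hM hY) //; definable.
have imgF al : Ord al ->
    (forall b, E b al -> E (F b) (T b) /\ next b (img F b) (F b)) ->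
    good (img F al).
  move=> oal ih; have mono b c : E b c -> E c al -> sub (F b) (F c).
    move=> bc ca; have bal := ord_tr oal ca bc.
    have [_ [_ [lF _]]] := ih c ca.
    apply: sub_trans lF; apply: sub_un; apply/cupP; left.
    by apply/(iP _ _ _ dF); exists b.
  split=> [q /(iP _ _ _ dF)[b ba ->]|q r /(iP _ _ _ dF)[b ba ->] /(iP _ _ _ dF)[c ca ->]].
    have [_ [Cb [lF _]]] := ih b ba; split=> //; apply: sub_trans lF.
    by apply: sub_un; apply/cupP; right; apply/prP; left.
  have [bc|->|cb] := ord_cmp hM hY (ord_mem hM oal ba) (ord_mem hM oal ca).
  - by left; apply: mono.
  - by left.
  - by right; apply: mono.
have FP al : Ord al -> E al k -> E (F al) (T al) /\ next al (img F al) (F al).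
  move: al; apply: (ord_ind hM hY); first by definable.
  move=> al oal ih ak.
  have ih' b : E b al -> E (F b) (T b) /\ next b (img F b) (F b).
    by move=> ba; apply: ih => //; apply: ord_tr ak ba.
  have gF := imgF al oal ih'.
  have hc := @sepI _ _ hM _ hY (T al) (next al (img F al)) ltac:(definable).
  rewrite hF //; apply/hc; apply: chP.
    move=> q /hc[qT _]; apply/unP; exists (T al) => //.
    by apply/(iP _ _ _ dT); exists al.
  have [|//|q qV nq] := stP al (img T al) (img F al).
    move=> q /(iP _ _ _ dF)[b ba ->]; apply/unP; exists (T b).
      by apply/(iP _ _ _ dT); exists b.
    by have [] := ih' b ba.
  by exists q; apply/hc; split=> //; rewrite hT.
have [Cq pq qF] := lbP _ (imgF k ok (fun b bk => FP b (ord_mem hM ok bk) bk)).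
exists (lb (img F k)); split=> // x /[dup] xa /gP[al alk gx].
have [_ [_ [_ Dx]]] := FP al (ord_mem hM ok alk) alk.
rewrite gx in Dx; apply: Dopen (Dx xa) => //; apply: qF.
by apply/(iP _ _ _ dF); exists al.
Qed.

End Recursion.

(** * Forcing *)

Section Generic.
Variables (M : Type) (E : M -> M -> Prop) (X : set (set M)) (Cond : M -> Prop).
Local Notation sub := (sub E).

(** The generic filter is represented by an increasing sequence cofinal in it. The last clause
    entails that every dense definable class is met. *)
Definition generic (ps : nat -> M) : Prop :=
  [/\ forall n, Cond (ps n), forall n, sub (ps n) (ps n.+1) &
    forall A : set M, dfn E X (fun s => A (s 0)) ->
      exists n, A (ps n) \/ forall r, Cond r -> sub (ps n) r -> ~ A r].

(** Rasiowa-Sikorski: [f] numbers the definable classes, and step [n] moves into the class numbered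
    [n] whenever some extension lies in it. *)
Lemma generic_ex p : countable [set A : set M | dfn E X (fun s => A (s 0))] ->
  Cond p -> exists ps, generic ps.
Proof.
move=> /countable_injP[f finj] Cp.
pose good n p r := [/\ Cond r, sub p r &
  exists A : set M, [/\ dfn E X (fun s => A (s 0)), f A = n & A r]].
pose next n p := match pselect (exists r, good n p r) with
  | left h => projT1 (cid h) | right _ => p end.
have nextP n q : Cond q -> Cond (next n q) /\ sub q (next n q).
  by rewrite /next; case: pselect => [h _|_ Cq]; [case: (projT2 (cid h))|split=> // x].
pose ps := fix ps n := if n is m.+1 then next m (ps m) else p.
have Cps n : Cond (ps n) by elim: n => //= n /(nextP n)[].
exists ps; split=> // [n|A dA]; first by have [] := nextP n _ (Cps n).
have [[r [Cr pr Ar]]|h] := pselect (exists r, [/\ Cond r, sub (ps (f A)) r & A r]);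
  last by exists (f A); right=> r Cr pr Ar; apply: h; exists r.
exists (f A).+1; left; rewrite /= /next; case: pselect => [h|[]]; last first.
  by exists r; split=> //; exists A.
case: (cid h) => /= q [_ _ [B [dB fB Bq]]].
by rewrite (_ : A = B) //; apply: finj; rewrite ?inE.
Qed.
End Generic.

Section Forcing.
Variables (M : Type) (E : M -> M -> Prop) (hM : ZFC E).
Variables (X : set (set M)) (hX : model E X).
Let singX : forall c, X [set c] := model_sing hX.
Local Notation sub := (sub E).
Variables (Cond : M -> Prop) (dC : dpred1 E X Cond).
Variables (ps : nat -> M) (gps : generic E X Cond ps).

Let Cps n : Cond (ps n). Proof. by case: gps. Qed.

Lemma generic_sub m n : m <= n -> sub (ps m) (ps n).
Proof.
move=> /subnK <-; elim: (n - m) => [|k ih]; first by move=> x.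
by apply: sub_trans ih _; case: gps.
Qed.

Let decide (A : set M) : dfn E X (fun s => A (s 0)) ->
  exists n, A (ps n) \/ forall r, Cond r -> sub (ps n) r -> ~ A r.
Proof. by case: gps => _ _; apply. Qed.

Section Invariance.
Variable sim : M -> M -> Prop.
Hypothesis sim_sym : forall p q, sim p q -> sim q p.
Hypothesis sim_ext : forall p q p', Cond p -> Cond q -> sim p q -> Cond p' ->
  sub p p' -> exists q', [/\ Cond q', sub q q' & sim p' q'].

(* [F s p] reads "p forces P at s"; it is stable under density and depends on p
   only up to the bisimulation [sim]. *)
Definition forcing_for (F : (nat -> M) -> M -> Prop) (P : (nat -> M) -> Prop) :=
  [/\ dfn E X (fun s => F (fun n => s n.+1) (s 0)),
      forall s p q, Cond q -> sub p q -> F s p -> F s q,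
      forall s p, Cond p -> (forall q, Cond q -> sub p q ->
        exists r, [/\ Cond r, sub q r & F s r]) -> F s p,
      forall s p q, Cond p -> Cond q -> sim p q -> F s p -> F s q &
      forall s, P s <-> exists n, F s (ps n)].

Definition forced P := exists F, forcing_for F P.

Lemma dfn_param (F : (nat -> M) -> M -> Prop) (f : nat -> (nat -> M) -> M) t :
  dfn E X (fun s => F (fun n => s n.+1) (s 0)) ->
  (forall n, dterm E X (f n)) -> dterm E X t ->
  dfn E X (fun s => F (fun n => f n s) (t s)).
Proof.
move=> dF df dt.
apply: (dfn_subst (f := fun n => if n is m.+1 then f m else t) dF).
by case.
Qed.

Lemma forced_ground P : dfn E X P -> forced P.
Proof.
move=> dP; exists (fun s _ => P s); split=> //.
- exact: (dfn_ren S dP).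
- by move=> s p Cp /(_ p Cp (fun _ => id))[r []].
- by move=> s; split=> [h|[]//]; exists 0.
Qed.

(** Forcing means that [at_] holds densely below [p]. It agrees with truth because the generic
    decides the class of conditions satisfying [at_]. *)
Lemma forced_atom (at_ : M -> M -> Prop) i : dpred2 E X at_ ->
  (forall p q x, sub p q -> at_ p x -> at_ q x) ->
  (forall p q x, sim p q -> at_ p x -> at_ q x) ->
  forced (fun s => exists n, at_ (ps n) (s i)).
Proof.
move=> dat mono inv.
exists (fun s p => forall q, Cond q -> sub p q ->
  exists r, [/\ Cond r, sub q r & at_ r (s i)]); split.
- definable.
- by move=> s p q Cq pq h r Cr qr; apply: h => //; apply: sub_trans qr.
- move=> s p Cp h q Cq pq; have [r [Cr qr]] := h q Cq pq.
  move=> /(_ r Cr (fun _ => id))[r' [Cr' rr' ar]].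
  by exists r'; split=> //; apply: sub_trans rr'.
- move=> s p q Cp Cq pq h q' Cq' qq'.
  have [p' [Cp' pp' qp']] := sim_ext Cq Cp (sim_sym pq) Cq' qq'.
  have [r [Cr pr ar]] := h p' Cp' pp'.
  have [r' [Cr' qr' rr']] := sim_ext Cp' Cq' (sim_sym qp') Cr pr.
  by exists r'; split=> //; apply: inv ar.
move=> s; split=> [[n an]|[n h]].
  by exists n => q Cq pq; exists q; split=> //; apply: mono an.
have [m [am|nm]] := @decide (fun p => at_ p (s i)) ltac:(definable).
  by exists m.
have [r [Cr qr ar]] := h (ps (maxn m n)) (Cps _) (generic_sub (leq_maxr _ _)).
case: (nm r Cr) => //; apply: sub_trans qr.
exact: generic_sub (leq_maxl _ _).
Qed.

(** A condition forces the implication if every extension forcing [P] forces [Q]. For truth, the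
    generic decides the class of conditions that force [P] and have no extension forcing [Q]. *)
Lemma forced_imp P Q : forced P -> forced Q -> forced (fun s => P s -> Q s).
Proof.
move=> [F [dF monoF _ invF PF]] [G [dG monoG regG invG QG]].
have dF' (r : nat -> nat) t : dterm E X t ->
    dfn E X (fun s => F (fun n => s (r n)) (t s)).
  by move=> dt; apply: (dfn_param (f := fun n s => s (r n)) dF) => // n; definable.
have dG' (r : nat -> nat) t : dterm E X t ->
    dfn E X (fun s => G (fun n => s (r n)) (t s)).
  by move=> dt; apply: (dfn_param (f := fun n s => s (r n)) dG) => // n; definable.
exists (fun s p => forall q, Cond q -> sub p q -> F s q -> G s q); split.
- definable.
- by move=> s p q Cq pq h r Cr qr; apply: h => //; apply: sub_trans qr.
- move=> s p Cp h q Cq pq Fq; apply: regG => // q' Cq' qq'.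
  have [||r [Cr qr]] := h q'; [by []|exact: sub_trans qq'|].
  move=> /(_ r Cr (fun _ => id)) Gr; exists r; split=> //; apply: Gr.
  by apply: monoF Fq => //; apply: sub_trans qr.
- move=> s p q Cp Cq pq h q' Cq' qq' Fq'.
  have [p' [Cp' pp' qp']] := sim_ext Cq Cp (sim_sym pq) Cq' qq'.
  by apply: (invG _ p') => //; [exact: sim_sym|apply: h => //; apply: invF Fq'].
move=> s; split=> [h|[n h] /PF[m Fm]]; last first.
  apply/QG; exists (maxn m n); apply: h => //.
    exact: generic_sub (leq_maxr _ _).
  by apply: monoF Fm => //; exact: generic_sub (leq_maxl _ _).
have dFs t : dterm E X t -> dfn E X (fun s' => F s (t s')).
  by move=> dt; apply: (dfn_param (f := fun n _ => s n) dF) => // n; definable.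
have dGs t : dterm E X t -> dfn E X (fun s' => G s (t s')).
  by move=> dt; apply: (dfn_param (f := fun n _ => s n) dG) => // n; definable.
have [n [[Fn nG]|hn]] := @decide (fun p =>
    F s p /\ forall r, Cond r -> sub p r -> ~ G s r) ltac:(definable).
  have /QG[m Gm] : Q s by apply/h/PF; exists n.
  case: (nG (ps (maxn m n))) => //; first exact: generic_sub (leq_maxr _ _).
  by apply: monoG Gm => //; exact: generic_sub (leq_maxl _ _).
exists n => q Cq nq Fq; apply: regG => // q' Cq' qq'.
apply: contrapT => nr; apply: (hn q' Cq' (sub_trans nq qq')).
split=> [|r Cr qr Gr]; first exact: monoF Fq.
by apply: nr; exists r.
Qed.

(** For truth, the generic decides the class of conditions that have, for some [x], no extension
    forcing the instance at [x]. *)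
Lemma forced_all P : forced P -> forced (fun s => forall x, P (scons x s)).
Proof.
move=> [F [dF monoF regF invF PF]].
have dFx : dfn E X (fun s => F (scons (s 0) (fun n => s n.+2)) (s 1)).
  pose f n (s : nat -> M) := if n is m.+1 then s m.+2 else s 0.
  apply: dfn_ext (dfn_param (f := f) (t := fun s => s 1) dF _ _) => [s||].
  - by rewrite (_ : (fun n => f n s) = scons (s 0) (fun n => s n.+2)) //;
      apply/funext; case.
  - by case=> [|n]; rewrite /f; definable.
  - exact: dterm_var.
have dFs s : dpred2 E X (fun x p => F (scons x s) p).
  move=> t u dt du; pose f n s' := if n is m.+1 then s m else t s'.
  apply: dfn_ext (dfn_param (f := f) (t := u) dF _ du) => [s'|].
  - by rewrite (_ : (fun n => f n s') = scons (t s') s) //;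
      apply/funext; case.
  - by case=> [|n]; rewrite /f; definable.
exists (fun s p => forall x, F (scons x s) p); split.
- exact: (dfn_all (P := fun s x => F (scons x (fun n => s n.+1)) (s 0))).
- by move=> s p q Cq pq h x; apply: monoF (h x).
- move=> s p Cp h x; apply: regF => // q Cq pq.
  by have [r [Cr qr Fr]] := h q Cq pq; exists r.
- by move=> s p q Cp Cq pq h x; apply: (invF _ p).
move=> s; split=> [h|[n hn] x]; last by apply/PF; exists n.
have [n [[x hx]|hn]] := @decide (fun p => exists x,
    forall r, Cond r -> sub p r -> ~ F (scons x s) r) ltac:(definable).
  have /PF[m Fm] := h x.
  case: (hx (ps (maxn m n))) => //; first exact: generic_sub (leq_maxr _ _).
  by apply: monoF Fm => //; exact: generic_sub (leq_maxl _ _).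
exists n => x; apply: regF => // q Cq nq; apply: contrapT => nr.
apply: (hn q Cq nq); exists x => r Cr qr Fr; apply: nr; exists r.
by split.
Qed.

Lemma forced_dfn (Y : set (set M)) :
  (forall A, Y A -> forall i, forced (fun s => A (s i))) ->
  forall P, dfn E Y P -> forced P.
Proof.
move=> hY P; elim=> {P}.
- by move=> i j; apply: forced_ground; exact: dfn_mem0.
- by move=> i j; apply: forced_ground; exact: dfn_eq0.
- by move=> i A /hY; apply.
- by apply: forced_ground; exact: dfn_bot.
- by move=> P Q _ hP _ hQ; apply: forced_imp.
- by move=> P _ hP; apply: forced_all.
Qed.

End Invariance.

(** With equality as the bisimulation, invariance is vacuous and [forced] is ordinary forcing. *)
Lemma eq_ext (p q p' : M) : Cond p -> Cond q -> p = q -> Cond p' ->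
  sub p p' -> exists q', [/\ Cond q', sub q q' & p' = q'].
Proof. by move=> _ _ <- Cp' pp'; exists p'. Qed.

Hypothesis chain : forall c, (forall q, E q c -> Cond q) ->
  (forall q r, E q c -> E r c -> sub q r \/ sub r q) -> Cond (un hM c).

(** By distributivity a single condition in the generic settles the values of the function at all
    arguments in [a]. On [a] the function is then definable in the ground model, where replacement
    applies. *)
Lemma generic_model (Y : set (set M)) : X `<=` Y ->
  (forall A, Y A -> forall i, forced eq (fun s => A (s i))) -> model E Y.
Proof.
move=> XY hY; split=> [c|P dP s a func]; first exact/XY/singX.
have [F [dF monoF regF _ PF]] := forced_dfn (@esym M) eq_ext hY dP.
pose G x y p := F (scons x (scons y s)) p.
have dG t u v : dterm E X t -> dterm E X u -> dterm E X v ->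
    dfn E X (fun s => G (t s) (u s) (v s)).
  move=> dt du dv.
  pose f n s' := match n with 0 => t s' | 1 => u s' | m.+2 => s m end.
  apply: dfn_ext (dfn_param (f := f) (t := v) dF _ dv) => [s'|].
  - by rewrite (_ : (fun n => f n s') = scons (t s') (scons (u s') s)) //;
      apply/funext => -[|[]].
  - by case=> [|[|n]]; rewrite /f //; definable.
(* The value at [x] is settled by [p]: some value is forced, or no extension forces any. *)
pose D x p := (exists y, G x y p) \/
  (forall y r, Cond r -> sub p r -> ~ G x y r).
have dD : dpred2 E X D by move=> t u dt du; rewrite /D; definable.
have Dopen x q r : Cond r -> sub q r -> D x q -> D x r.
  move=> Cr qr [[y Gy]|h]; first by left; exists y; apply: monoF Gy.
  by right=> y r' Cr' rr'; apply: h => //; apply: sub_trans rr'.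
have Ddense x q : E x a -> Cond q -> exists r, [/\ Cond r, sub q r & D x r].
  move=> _ Cq; have [[r [y [Cr qr Gr]]]|h] :=
      pselect (exists r, exists y, [/\ Cond r, sub q r & G x y r]).
    by exists r; split=> //; left; exists y.
  by exists q; split=> //; right=> y r Cr qr Gr; apply: h; exists r, y.
have [n hn] : exists n, forall x, E x a -> D x (ps n).
  have [n [hn|hn]] := @decide (fun p => forall x, E x a -> D x p) ltac:(definable).
    by exists n.
  have [q [Cq nq Dq]] := distributive hX dC dD chain Dopen Ddense (Cps n).
  by case: (hn q Cq nq).
have PG x y : E x a -> P (scons x (scons y s)) <-> G x y (ps n).
  move=> xa; split=> [Pxy|Gn]; last by apply/PF; exists n.
  have /PF[k Fk] := Pxy; have [[y' Gy']|h] := hn x xa.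
    by rewrite (func x y y') //; apply/PF; exists n.
  case: (h y (ps (maxn k n))) => //; first exact: generic_sub (leq_maxr _ _).
  by apply: monoF Fk => //; exact: generic_sub (leq_maxl _ _).
have [||b hb] := @model_repl _ _ _ hX
  (fun s' => E (s' 0) a /\ G (s' 0) (s' 1) (ps n)) _ s a.
- by definable.
- by move=> x y y' xa [_ /(PG _ _ xa) Py] [_ /(PG _ _ xa) Py']; apply: func Py Py'.
exists b => y; rewrite hb; split=> [[x xa [_ /(PG _ _ xa)]]|[x xa /(PG _ _ xa)]];
  by exists x.
Qed.

End Forcing.

(** * Formulas and realizations *)

Fixpoint ren (K : Type) (r : nat -> nat) (f : formula K) : formula K :=
  match f with
  | FMem i j => FMem (r i) (r j)
  | FEq i j => FEq (r i) (r j)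
  | FMemClass i k => FMemClass (r i) k
  | FEqClass k l => FEqClass k l
  | FBot => FBot
  | FImp g h => FImp (ren r g) (ren r h)
  | FAll g => FAll (ren (fun n => if n is m.+1 then (r m).+1 else 0) g)
  end.

(** A Goedel numbering; its injectivity makes the definable classes countable. *)
Fixpoint code (f : formula nat) : nat :=
  match f with
  | FMem i j => pickle (0, pickle (i, j))
  | FEq i j => pickle (1, pickle (i, j))
  | FMemClass i k => pickle (2, pickle (i, k))
  | FEqClass k l => pickle (3, pickle (k, l))
  | FBot => pickle (4, 0)
  | FImp g h => pickle (5, pickle (code g, code h))
  | FAll g => pickle (6, code g)
  end.

Lemma code_inj : injective code.
Proof.
have pI (T : countType) : injective (@pickle T) := pcan_inj pickleK.
elim=> [i j|i j|i k|k l||g ihg h ihh|g ihg] [i' j'|i' j'|i' k'|k' l'||g' h'|g'] //=;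
  move=> /pI[] //.
- by move=> /pI[-> ->].
- by move=> /pI[-> ->].
- by move=> /pI[-> ->].
- by move=> /pI[-> ->].
- by move=> /pI[eg eh]; rewrite (ihg _ eg) (ihh _ eh).
- by move=> eg; rewrite (ihg _ eg).
Qed.

Section Formulas.
Variables (M : Type) (E : M -> M -> Prop).

Lemma scons_ren x (s : nat -> M) r :
  scons x (fun n => s (r n)) =
  (fun n => scons x s (if n is m.+1 then (r m).+1 else 0)).
Proof. by apply/funext; case. Qed.

Lemma sat_ren (K : Type) (C : K -> set M) s r (f : formula K) :
  sat E C s (ren r f) <-> sat E C (fun n => s (r n)) f.
Proof.
elim: f s r => //= [g ihg h ihh s r|g ihg s r].
  by split=> k /ihg /k /ihh.
by split=> h x; have := h x; rewrite (scons_ren x s r) ihg.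
Qed.

Definition classes (Y : set (set M)) : set (set M) :=
  [set A : set M | dfn E Y (fun s => A (s 0))].

(** This passes from syntax to [dfn], and [dfn_formula] goes back. An equation between classes is
    independent of the assignment, hence a constant predicate. *)
Lemma dfn_sat (Y : set (set M)) (K : Type) (C : K -> set M) f :
  (forall k, classes Y (C k)) -> dfn E Y (fun s => sat E C s f).
Proof.
move=> hC; elim: f => [i j|i j|i k|k l||g ihg h ihh|g ihg] /=.
- exact: dfn_mem0.
- exact: dfn_eq0.
- exact: (proj1 (dpred1P E Y (C k)) (hC k)) (dterm_var E Y i).
- exact: dfn_const.
- exact: dfn_bot.
- exact: dfn_imp.
- exact: (dfn_all0 ihg).
Qed.

Lemma dfn_formula (Y : set (set M)) (C : nat -> set M) P :
  (forall A, Y A -> exists k, C k = A) -> dfn E Y P ->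
  exists f, forall s, sat E C s f <-> P s.
Proof.
move=> hC; elim=> {P}.
- by move=> i j; exists (FMem i j).
- by move=> i j; exists (FEq i j).
- by move=> i A /hC[k <-]; exists (FMemClass i k).
- by exists FBot.
- move=> P Q _ [f hf] _ [g hg]; exists (FImp f g) => s /=.
  by split=> h /hf /h /hg.
- by move=> P _ [f hf]; exists (FAll f) => s /=; split=> h x; apply/hf.
Qed.

Lemma enumeration (T : Type) (A : set T) (x0 : T) : countable A ->
  exists c : nat -> T, forall x, A x -> exists n, c n = x.
Proof.
move=> /countable_injP[f finj].
exists (fun n => match pselect (exists x, A x /\ f x = n) with
  | left h => projT1 (cid h) | right _ => x0 end) => x Ax.
exists (f x); case: pselect => [h|[]]; last by exists x.
by case: (cid h) => y [Ay fyx] /=; apply: finj; rewrite ?inE.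
Qed.

Lemma countable_classes (Y : set (set M)) : countable Y -> countable (classes Y).
Proof.
move=> /(enumeration set0)[C hC].
have ex A : exists f, classes Y A -> forall x, sat E C (fun _ => x) f <-> A x.
  have [dA|nA] := pselect (classes Y A); last by exists FBot => /nA.
  by have [f hf] := dfn_formula hC dA; exists f => _ x; apply: hf.
apply/countable_injP; exists (fun A => code (projT1 (cid (ex A)))).
move=> A B; rewrite !inE => dA dB /code_inj.
case: (cid (ex A)) => /= f /(_ dA) hf; case: (cid (ex B)) => /= g /(_ dB) hg fg.
by subst g; apply/funext => x; apply/propext; rewrite -hf hg.
Qed.

(** Class Replacement is an instance of the scheme in [model]; Elementary Comprehension holds
    because definability from classes definable over [Y] is again definability over [Y]. *)
Lemma GBC_of_model (hM : ZFC E) (Y : set (set M)) : model E Y ->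
  (exists2 F, classes Y F & bijection_Ord_V E F) -> GBC E (classes Y).
Proof.
move=> hY choiceY; split=> //.
- by move=> A B _ _ AB; apply/funext => x; apply/propext.
- move=> F dF [_ fun_F] a; have singY := model_sing hY.
  have /dpred1P dF' := dF.
  have d : dfn E Y (fun s => maps_to E F (s 0) (s 1)).
    apply: (dfn_ext (P := fun s => F (opr hM (s 0) (s 1)))) => [s|].
      exact: (iff_sym (maps_toP hM F (s 0) (s 1))).
    definable.
  have [|b hb] := @model_repl _ _ _ hY _ d (fun _ => a) a; last by exists b.
  by move=> x y y' _; apply: fun_F.
move=> f s C hC; have singY := model_sing hY.
pose g n s' := if n is m.+1 then s m else s' 0.
apply: dfn_ext (dfn_subst (f := g) (dfn_sat f hC) _) => [s'|].
  by rewrite (_ : (fun n => g n s') = scons (s' 0) s) //; apply/funext; case.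
by case=> [|n]; rewrite /g; definable.
Qed.

Lemma classes_GBC X : GBC E X -> countable X -> classes X `<=` X /\
  (forall P, dfn E X P -> forall s, X [set x | P (scons x s)]).
Proof.
move=> gX /[dup] cX; have [F0 XF0 _] := gbc_global_choice gX.
move=> /countable_injP[f finj].
(* One sequence lists all classes of [X]. Its default value is a class of [X], as Elementary
   Comprehension asks every parameter to be one. *)
pose C n := match pselect (exists A, X A /\ f A = n) with
  | left h => projT1 (cid h) | right _ => F0 end.
have XC n : X (C n).
  by rewrite /C; case: pselect => // h; case: (cid h) => A [].
have hC A : X A -> exists k, C k = A.
  move=> XA; exists (f A); rewrite /C; case: pselect => [h|[]]; last by exists A.
  by case: (cid h) => B [XB fBA] /=; apply: finj; rewrite ?inE.
have comp P : dfn E X P -> forall s, X [set x | P (scons x s)].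
  move=> /(dfn_formula hC)[g hg] s.
  rewrite (_ : [set x | _] = [set x | sat E C (scons x s) g]).
    exact: gbc_elementary_comprehension.
  by apply: eq_set => x; apply/propext; rewrite hg.
split=> // A dA; have := comp _ dA.
have [e _] := ex_empty (gbc_ZFC gX).
by move=> /(_ (fun _ => e)).
Qed.

(** The predicate is functional only on [a], so the class of pairs handed to Class Replacement is
    restricted to first components in [a]. *)
Lemma model_of_GBC X : GBC E X -> countable X -> model E X.
Proof.
move=> gX cX; have [clX comp] := classes_GBC gX cX.
have hM := gbc_ZFC gX.
have singX c : X [set c].
  exact: (comp _ (dfn_eq0 E X 0 1) (fun _ => c)).
split=> // P dP s a func.
have dP' : dpred2 E X (fun x y => P (scons x (scons y s))).
  move=> t u dt du.
  pose f n s' := match n with 0 => t s' | 1 => u s' | m.+2 => s m end.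
  apply: dfn_ext (dfn_subst (f := f) dP _) => [s'|].
    by rewrite (_ : (fun n => f n s') = scons (t s') (scons (u s') s));
      last by apply/funext => -[|[]].
  by case=> [|[|n]]; rewrite /f //; definable.
pose F : set M := [set p | exists x y,
  [/\ p = opr hM x y, E x a & P (scons x (scons y s))]].
have XF : X F by apply: clX; rewrite /classes /F /=; definable.
have mF x y : maps_to E F x y <-> E x a /\ P (scons x (scons y s)).
  rewrite (maps_toP hM); split=> [[x' [y' [/(@opr_inj _ _ hM)[-> ->]]]]|[xa Pxy]] //.
  by exists x, y.
have [|b hb] := @gbc_class_replacement _ _ _ gX F XF _ a.
  split=> [p [x [y [-> _ _]]]|x y y' /mF[xa Pxy] /mF[_ Pxy']].
    by exists x, y; apply/is_oprP.
  exact: func Pxy Pxy'.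
by exists b => y; rewrite hb; split=> [[x xa /mF[]]|[x xa Pxy]]; exists x => //; apply/mF.
Qed.

Definition singletons : set (set M) := [set A | exists c, A = [set c]].

(* Parameters are interleaved with the assignment: an even variable 2n stands
   for variable n, an odd one for a parameter. *)
Let il (c s : nat -> M) : nat -> M := fun n => if odd n then c n./2 else s n./2.

(** A new value for variable 0 moves the even positions by two and leaves the odd ones in place,
    while pushing it on the interleaved assignment moves all positions by one. The renaming makes up
    the difference, with [0.-1 = 0] fixing variable 0. *)
Let il_scons c x s : il c (scons x s) =
  (fun n => scons x (il c s) (if odd n then n.+1 else n.-1)).
Proof.
apply/funext => n; rewrite /il; case: (boolP (odd n)) => on /=.
  by rewrite on.
case: n on => [|[//|n]] //=; rewrite negbK => /negbTE on.
by rewrite on.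
Qed.

(** As [c] lists all of [M], membership in a singleton becomes an equation with an odd variable, and
    class parameters disappear. *)
Let dfn_void c : (forall x, exists n, c n = x) -> forall P, dfn E singletons P ->
  exists f : formula void, forall s, sat E (@no_class M) (il c s) f <-> P s.
Proof.
move=> hc P; elim=> {P}.
- by move=> i j; exists (FMem i.*2 j.*2) => s; rewrite /= /il !odd_double !doubleK.
- by move=> i j; exists (FEq i.*2 j.*2) => s; rewrite /= /il !odd_double !doubleK.
- move=> i _ [x ->]; have [n <-] := hc x; exists (FEq i.*2 n.*2.+1) => s.
  by rewrite /= /il /= !odd_double doubleK uphalf_double.
- by exists FBot.
- move=> P Q _ [f hf] _ [g hg]; exists (FImp f g) => s /=.
  by split=> h /hf /h /hg.
move=> P _ [f hf].
exists (FAll (ren (fun n => if odd n then n.+1 else n.-1) f)) => s /=.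
split=> h x; first by have /sat_ren := h x; rewrite -il_scons => /hf.
by apply/sat_ren; rewrite -il_scons; apply/hf.
Qed.

Lemma model_singletons (hM : ZFC E) : countable [set: M] -> model E singletons.
Proof.
move=> cM; have [x0 _] := ex_empty hM.
have [c hc] := enumeration x0 cM.
split=> [x|P dP s a func]; first by exists x.
have [|f hf] := @dfn_void c _ _ dP; first by move=> x; apply: hc.
(* Two values are pushed: [r] corrects the positions for one of them, and its lift [ur] does so for
   the other. *)
pose r n := if odd n then n.+1 else n.-1.
pose ur n := if n is m.+1 then (r m).+1 else 0.
have satP x y : sat E (@no_class M) (scons x (scons y (il c s)))
    (ren (fun n => ur (r n)) f) <-> P (scons x (scons y s)).
  rewrite -hf sat_ren il_scons (il_scons c y s).
  by rewrite (scons_ren x (scons y (il c s)) r).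
have [|b hb] := @zfc_replacement _ _ hM (ren (fun n => ur (r n)) f) (il c s) a.
  by move=> x y y' xa /satP Pxy /satP; apply: func Pxy.
exists b => y; rewrite hb.
by split=> -[x xa h]; exists x => //; apply/satP.
Qed.

End Formulas.

(** * Forcing Global Choice *)

Lemma countable_setU (T : Type) (A B : set T) :
  countable A -> countable B -> countable (A `|` B).
Proof.
move=> cA cB; rewrite (_ : A `|` B = \bigcup_b (if b then A else B)).
  by apply: bigcup_countable => [|[]].
apply/seteqP; split=> x; first by case; [exists true|exists false].
by move=> [[] _ h]; [left|right].
Qed.

Section GlobalChoice.
Variables (M : Type) (E : M -> M -> Prop) (hM : ZFC E).
Local Notation sub := (sub E).
Local Notation opr := (opr hM).
Local Notation cup := (cup hM).
Local Notation pr := (pr hM).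
Local Notation Ord := (is_ordinal E).

Definition dom_of (p a : M) : Prop :=
  Ord a /\ forall x, E x a <-> exists y, E (opr x y) p.

Definition ord_injection (p : M) : Prop :=
  [/\ forall z, E z p -> exists x y, z = opr x y,
      forall x y y', E (opr x y) p -> E (opr x y') p -> y = y',
      forall x x' y, E (opr x y) p -> E (opr x' y) p -> x = x' &
      exists a, dom_of p a].

Lemma dpred_ord_injection (Y : set (set M)) : model E Y ->
  dpred1 E Y ord_injection.
Proof.
move=> /model_sing singY t dt; rewrite /ord_injection /dom_of; definable.
Qed.

(** The domain of the union is the supremum of the domains, which form a set by replacement. *)
Lemma ord_injection_chain (Y : set (set M)) c : model E Y ->
  (forall q, E q c -> ord_injection q) ->
  (forall q r, E q c -> E r c -> sub q r \/ sub r q) -> ord_injection (un hM c).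
Proof.
move=> hY; have singY := model_sing hY; move=> cI cch.
have common x y : E x (un hM c) -> E y (un hM c) ->
    exists q, [/\ E q c, E x q & E y q].
  move=> /unP[q qc xq] /unP[r rc yr].
  by have [qr|rq] := cch q r qc rc; [exists r|exists q]; split=> //;
    [exact: qr|exact: rq].
split.
- by move=> z /unP[q /cI[h _ _ _] /h].
- move=> x y y' h h'; have [q [/cI[_ f _ _] hq hq']] := common _ _ h h'.
  exact: f hq hq'.
- move=> x x' y h h'; have [q [/cI[_ _ f _] hq hq']] := common _ _ h h'.
  exact: f hq hq'.
pose dom q := mu hM (dom_of q).
have domP q : E q c -> dom_of q (dom q).
  move=> /cI[_ _ _ [a qa]]; rewrite /dom (@muE _ _ hM _ a) // => b [ob qb].
  by case: qa => oa qa; apply: (eext hM) => z; rewrite qa qb.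
have iP z : E z (img hM dom c) <-> exists2 q, E q c & z = dom q.
  by rewrite (imgP hM hY) // /dom /dom_of; definable.
exists (un hM (img hM dom c)); split.
  by apply: (ord_un hM hY) => x /iP[q /domP[oq _] ->].
move=> x; split=> [/unP[_ /iP[q qc ->]]|[y /unP[q qc xyq]]].
  have [_ ->] := domP q qc; move=> [y xyq].
  by exists y; apply/unP; exists q.
apply/unP; exists (dom q); first by apply/iP; exists q.
by have [_ ->] := domP q qc; exists y.
Qed.

Lemma ord_injection_emp (Y : set (set M)) : model E Y -> ord_injection (emp hM).
Proof.
move=> hY; have h z := @empP _ _ hM z; split=> [z /h|x y y' /h|x x' y /h|] //.
exists (emp hM); split=> [|x]; first exact: ord_emp.
by split=> [/h|[y /h]].
Qed.

(** Unless [y] is already a value, it is appended at the first free index, the domain [a] of [p]. *)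
Lemma ord_injection_extend (Y : set (set M)) p y : model E Y ->
  ord_injection p -> exists q x, [/\ ord_injection q, sub p q & E (opr x y) q].
Proof.
move=> hY [pp pf pI [a [oa pa]]].
have [[x xy]|ny] := pselect (exists x, E (opr x y) p).
  by exists p, x; split=> //; split=> //; exists a.
have nya y' : ~ E (opr a y') p by move=> h; apply: (irr hM (x := a)); apply/pa; exists y'.
pose q := cup p (pr (opr a y) (opr a y)).
have qP z : E z q <-> E z p \/ z = opr a y.
  by rewrite cupP prP; split=> [[|[]]|[|]]; auto.
exists q, a; split; [split| |].
- by move=> z /qP[/pp//|->]; exists a, y.
- move=> x u v /qP[h|/(@opr_inj _ _ hM)[-> ->]] /qP[h'|/(@opr_inj _ _ hM)[e ->]] //.
  + exact: pf h h'.
  + by rewrite e in h; case: (nya _ h).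
  + by case: (nya _ h').
- move=> x x' v /qP[h|/(@opr_inj _ _ hM)[-> ->]] /qP[h'|/(@opr_inj _ _ hM)[-> e]] //.
  + exact: pI h h'.
  + by rewrite e in h; case: ny; exists x.
  + by case: ny; exists x'.
- exists (succ hM a); split=> [|x]; first exact: (ord_succ hM hY).
  split=> [/succP[/pa[v h]|->]|[v /qP[h|/(@opr_inj _ _ hM)[-> _]]]].
  + by exists v; apply/qP; left.
  + by exists y; apply/qP; right.
  + by apply/succP; left; apply/pa; exists v.
  + by apply/succP; right.
- by move=> z zp; apply/qP; left.
- by apply/qP; right.
Qed.

Lemma GBC_exists : countable [set: M] -> exists2 X, GBC E X & countable X.
Proof.
move=> cM; have h0 := model_singletons hM cM.
have sing0 := model_sing h0.
have c0 : countable (@singletons M).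
  have -> : @singletons M = [set [set c] | c in [set: M]].
    by apply/seteqP; split=> A /= [c]; [move=> ->; exists c|move=> _ <-; exists c].
  exact: sub_countable (card_image_le _ _) cM.
have dI := dpred_ord_injection h0.
have [ps gps] := generic_ex (countable_classes E c0) (ord_injection_emp h0).
have [Ips _ decide] := gps; have ps_sub := generic_sub gps.
pose G : set M := [set x | exists n, E x (ps n)].
pose Y : set (set M) := @singletons M `|` [set G].
have hY : model E Y.
  apply: (generic_model h0 dI gps) => [c||A [A0|->] i].
  - exact: (ord_injection_chain h0).
  - by move=> A; left.
  - by apply: forced_ground; apply: dfn_cls0.
  - apply: (forced_atom (at_ := fun p x => E x p) h0 dI gps (@esym M) (@eq_ext _ _ _)).
    + by definable.
    + by move=> p q x pq; exact: pq.
    + by move=> p q x ->.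
have singY := model_sing hY.
have dG : dpred1 E Y G by move=> t dt; apply: dfn_cls => //; right.
have common x y : G x -> G y -> exists n, E x (ps n) /\ E y (ps n).
  move=> [m xm] [n yn]; exists (maxn m n); split.
    exact: ps_sub (leq_maxl _ _) _ xm.
  exact: ps_sub (leq_maxr _ _) _ yn.
have surj y : exists x, G (opr x y).
  have [n [[x h]|h]] := decide (fun p => exists x, E (opr x y) p) ltac:(definable).
    by exists x, n.
  have [q [x [Iq nq xyq]]] := ord_injection_extend y h0 (Ips n).
  by case: (h q Iq nq); exists x.
exists (classes E Y).
  apply: (GBC_of_model hM) => //; exists G; first by apply: dG; exact: dterm_var.
  split.
  - split=> [p [n pn]|x y y' /(maps_toP hM) h /(maps_toP hM) h'].
      have [pp _ _ _] := Ips n; have [x [y ->]] := pp _ pn.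
      by exists x, y; apply/is_oprP.
    have [n [hn hn']] := common _ _ h h'; have [_ f _ _] := Ips n.
    exact: f hn hn'.
  - move=> x; split=> [ox|[y /(maps_toP hM)[n xyn]]]; last first.
      have [_ _ _ [a [oa na]]] := Ips n.
      by apply: (ord_mem hM oa); apply/na; exists y.
    (* If [x] were outside the domain, all indices would lie below [x]. As [G] is onto, replacement
       would make the whole universe a set [b], and [b] would belong to itself. *)
    apply: contrapT => nx.
    have Gx z y : G (opr z y) -> E z x.
      move=> [n zyn]; have [_ _ _ [a [oa na]]] := Ips n.
      have za : E z a by apply/na; exists y.
      have xa : ~ E x a.
        by move=> /na[u xu]; apply: nx; exists u; apply/(maps_toP hM); exists n.
      have [//|zx|xz] := ord_cmp hM hY (ord_mem hM oa za) ox.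
        by case: xa; rewrite -zx.
      by case: xa; apply: ord_tr xz.
    have [||b hb] := @model_repl _ _ _ hY (fun s => G (opr (s 0) (s 1))) _ (fun _ => x) x.
    + by definable.
    + move=> z y y' _ /= h h'; have [n [hn hn']] := common _ _ h h'.
      by have [_ f _ _] := Ips n; exact: f hn hn'.
    apply: (irr hM (x := b)); apply/hb; have [z zb] := surj b.
    by exists z => //; apply: Gx zb.
  - move=> x x' y /(maps_toP hM) h /(maps_toP hM) h'.
    have [n [hn hn']] := common _ _ h h'; have [_ _ f _] := Ips n.
    exact: f hn hn'.
  - by move=> y; have [x h] := surj y; exists x; apply/(maps_toP hM).
by apply/countable_classes/countable_setU => //; exact: countable1.
Qed.

End GlobalChoice.

(** * Mutually generic classes *)

Section MutuallyGeneric.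
Variables (M : Type) (E : M -> M -> Prop) (hM : ZFC E).
Local Notation sub := (sub E).
Local Notation opr := (opr hM).
Local Notation un := (un hM).
Local Notation cup := (cup hM).
Local Notation pr := (pr hM).
Local Notation emp := (emp hM).

Lemma opr_un x y s : E (opr x y) s -> E y (un (un s)).
Proof.
move=> h; apply/unP; exists (pr x y); last by apply/prP; right.
by apply/unP; exists (opr x y) => //; apply/prP; right.
Qed.

(** Zermelo numerals of the external natural numbers, serving both as tags in conditions and as
    labels of slices. *)
Definition numeral (n : nat) : M := iter n (fun x => pr x x) emp.

Lemma numeral_inj : injective numeral.
Proof.
have n0 x : pr x x <> emp.
  by move=> h; apply: (@empP _ _ hM x); rewrite -h; apply/prP; left.
elim=> [|n ih] [|m] //= h; first by case: (n0 _ (esym h)).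
  by case: (n0 _ h).
by have [/ih ->] := sing_inj h.
Qed.

Definition pos x := opr (numeral 1) x.
Definition neg x := opr (numeral 0) x.

Lemma pos_inj x y : pos x = pos y -> x = y.
Proof. by move/(@opr_inj _ _ hM) => []. Qed.

Lemma neg_inj x y : neg x = neg y -> x = y.
Proof. by move/(@opr_inj _ _ hM) => []. Qed.

Lemma pos_neg x y : pos x <> neg y.
Proof. by move/(@opr_inj _ _ hM) => [/numeral_inj]. Qed.

(* A condition puts x into the generic class if it contains [pos x], and keeps x
   out of it if it contains [neg x]. *)
Definition cohen (p : M) : Prop := forall x, ~ (E (pos x) p /\ E (neg x) p).

Definition slice (a : M) : set M := [set x | exists y, x = opr a y].

Lemma slice_disjoint a b x : slice a x -> slice b x -> a = b.
Proof. by move=> [y ->] [z /(@opr_inj _ _ hM)[]]. Qed.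

(** Let [y] be the fourfold union of [p]. If [p] mentioned the pair of [a] and [y], undoing two
    pairings would place [y] in itself. *)
Lemma slice_proper a p :
  exists x, [/\ slice a x, ~ E (pos x) p & ~ E (neg x) p].
Proof.
apply: contrapT => h; apply: (irr hM (x := un (un (un (un p))))).
set y := un _; apply: (@opr_un a y); apply: contrapT => nxy; apply: h.
exists (opr a y); split; first by exists y.
  by move=> /opr_un.
by move=> /opr_un.
Qed.

(** The bisimulation used for independence: the two conditions may differ in what they say on [B],
    and in elements that are neither [pos x] nor [neg x]. *)
Definition agree (B : set M) (p q : M) : Prop := forall x, ~ B x ->
  (E (pos x) p <-> E (pos x) q) /\ (E (neg x) p <-> E (neg x) q).

Lemma agree_sym B p q : agree B p q -> agree B q p.
Proof. by move=> h x /h[? ?]; split; apply: iff_sym. Qed.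

Section OverModel.
Variables (X : set (set M)) (hX : model E X).
Let singX : forall c, X [set c] := model_sing hX.

Lemma dterm_pos : dfun1 E X pos.
Proof. by move=> t dt; rewrite /pos; definable. Qed.

Lemma dterm_neg : dfun1 E X neg.
Proof. by move=> t dt; rewrite /neg; definable. Qed.

Let dpos := dterm_pos.
Let dneg := dterm_neg.

Lemma dpred_cohen : dpred1 E X cohen.
Proof. by move=> t dt; rewrite /cohen; definable. Qed.

Lemma dpred_slice a : dpred1 E X (slice a).
Proof. by move=> t dt; rewrite /slice /=; definable. Qed.

Lemma cohen_chain c : (forall q, E q c -> cohen q) ->
  (forall q r, E q c -> E r c -> sub q r \/ sub r q) -> cohen (un c).
Proof.
move=> cC cch x [/unP[q qc xq] /unP[r rc xr]].
have [qr|rq] := cch q r qc rc.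
  by apply: (cC r rc x); split=> //; apply: qr.
by apply: (cC q qc x); split=> //; apply: rq.
Qed.

(** The extension adds to [q] what [p'] says off the slice. There [q] agrees with [p], hence is
    compatible with [p']; on the slice [q] is left unchanged. *)
Lemma agree_ext a p q p' : cohen p -> cohen q -> agree (slice a) p q ->
  cohen p' -> sub p p' ->
  exists q', [/\ cohen q', sub q q' & agree (slice a) p' q'].
Proof.
move=> Cp Cq pq Cp' pp'.
pose out z := forall x, slice a x -> z <> pos x /\ z <> neg x.
have dsl := dpred_slice a.
have hc := @sepI _ _ hM _ hX p' out ltac:(rewrite /out; definable).
set c := cmp _ _ in hc.
have op x : ~ slice a x -> out (pos x).
  by move=> nx y ay; split=> [/pos_inj e|/pos_neg//]; apply: nx; rewrite e.
have on x : ~ slice a x -> out (neg x).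
  by move=> nx y ay; split=> [/esym/pos_neg//|/neg_inj e]; apply: nx; rewrite e.
exists (cup q c); split.
- move=> x [/cupP xp /cupP xn]; have [ax|nax] := pselect (slice a x).
    apply: (Cq x); split.
      by case: xp => // /hc[_ /(_ x ax)[]].
    by case: xn => // /hc[_ /(_ x ax)[]].
  have [pp pn] := pq x nax; apply: (Cp' x); split.
    by case: xp => [/pp/pp'|/hc[]].
  by case: xn => [/pn/pp'|/hc[]].
- by move=> z zq; apply/cupP; left.
move=> x nax; have [pp pn] := pq x nax; split; split.
- by move=> h; apply/cupP; right; apply/hc; split=> //; apply: op.
- by move=> /cupP[/pp/pp'|/hc[]].
- by move=> h; apply/cupP; right; apply/hc; split=> //; apply: on.
- by move=> /cupP[/pn/pp'|/hc[]].
Qed.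

Variables (ps : nat -> M) (gps : generic E X cohen ps).

Definition generic_slice (a : M) : set M :=
  [set x | exists n, slice a x /\ E (pos x) (ps n)].

Lemma forced_slice sim a i :
  (forall p q, sim p q -> sim q p) ->
  (forall p q p', cohen p -> cohen q -> sim p q -> cohen p' ->
    sub p p' -> exists q', [/\ cohen q', sub q q' & sim p' q']) ->
  (forall p q x, sim p q -> slice a x -> E (pos x) p -> E (pos x) q) ->
  forced E X cohen ps sim (fun s => generic_slice a (s i)).
Proof.
move=> sim_sym sim_ext inv; have dsl := dpred_slice a.
apply: (forced_atom (at_ := fun p x => slice a x /\ E (pos x) p) hX
  dpred_cohen gps sim_sym sim_ext).
- by definable.
- by move=> p q x pq [ax xp]; split=> //; apply: pq.
- by move=> p q x pq [ax xp]; split=> //; apply: inv xp.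
Qed.

Definition slice_extension (I : set M) : set (set M) :=
  X `|` [set A | exists2 a, I a & A = generic_slice a].

Lemma model_slice_extension I : model E (slice_extension I).
Proof.
apply: (generic_model hX dpred_cohen gps (hM := hM)).
- exact: cohen_chain.
- by move=> A; left.
move=> A [XA|[a _ ->]] i; first by apply: forced_ground; apply: dfn_cls0.
apply: forced_slice => //; first exact: eq_ext.
by move=> p q x ->.
Qed.

Lemma generic_slice_notin I a : ~ I a ->
  ~ classes E (slice_extension I) (generic_slice a).
Proof.
move=> nIa dG; have ps_sub := generic_sub gps; have [Cps _ decide] := gps.
(* All parameters are ground classes or slices with a label other than [a], so the forcing relation
   of the supposed definition ignores slice [a]. *)
have [F [dF monoF _ invF GF]] : forced E X cohen ps (agree (slice a))
    (fun s => generic_slice a (s 0)).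
  apply: forced_dfn dG => //; first exact: dpred_cohen.
  - exact: agree_sym.
  - exact: agree_ext.
  move=> A [XA|[b Ib ->]] i; first by apply: forced_ground; apply: dfn_cls0.
  apply: forced_slice; [exact: agree_sym|exact: agree_ext|].
  move=> p q x pq bx; have [] // := pq x _.
    by move=> ax; apply: nIa; rewrite (slice_disjoint ax bx).
  by move=> ->.
pose Fx x p := F (fun _ => x) p.
have dFx : dpred2 E X Fx.
  by move=> t u dt du; apply: (dfn_param (f := fun _ => t) dF).
have dsl := dpred_slice a; have dC := dpred_cohen.
(* Conditions in [D] refute the definition at some [x] of the slice: they force [x] in but contain
   [neg x], or contain [pos x] and have no extension forcing [x] in. *)
pose D p := exists x, slice a x /\ ((Fx x p /\ E (neg x) p) \/
  (E (pos x) p /\ forall r, cohen r -> sub p r -> ~ Fx x r)).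
have [n [[x [ax [[Fn nx]|[px nF]]]]|nD]] := decide D ltac:(rewrite /D; definable).
- have /GF/=[m [_ xm]] : exists n, F (fun _ => x) (ps n) by exists n.
  apply: (Cps (maxn m n) x); split.
    exact: ps_sub (leq_maxl _ _) _ xm.
  exact: ps_sub (leq_maxr _ _) _ nx.
- have /(GF (fun _ => x))[m Fm] : generic_slice a x by exists n.
  apply: (nF (ps (maxn m n))) => //; first exact: ps_sub (leq_maxr _ _).
  by apply: monoF Fm => //; exact: ps_sub (leq_maxl _ _).
(* No extension of [ps n] lies in [D]. At an [x] on which [ps n] is silent, such an extension is now
   built. *)
have [x [ax xp xn]] := slice_proper a (ps n).
have inp u v z : E z (cup u (pr v v)) <-> E z u \/ z = v.
  by rewrite cupP prP; split=> [[|[]]|[|]]; auto.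
have [[q [Cq nq Fq]]|nF] :=
    pselect (exists q, [/\ cohen q, sub (ps n) q & Fx x q]); last first.
  pose r := cup (ps n) (pr (pos x) (pos x)).
  have Cr : cohen r.
    move=> y [/inp[yp|yp] /inp[yn|/esym/pos_neg//]].
      by apply: (Cps n y).
    by rewrite (pos_inj yp) in yn.
  have nr : sub (ps n) r by move=> z zn; apply/inp; left.
  apply: (nD r Cr nr); exists x; split=> //; right; split; first by apply/inp; right.
  move=> r' Cr' rr' Fr'; apply: nF; exists r'; split=> //.
  exact: sub_trans nr rr'.
(* Here [q] forces [x] in. Exchanging [pos x] for [neg x] changes [q] only on slice [a], so the new
   condition still forces it, and it extends [ps n], which lacks [pos x]. *)
have hc := @sepI _ _ hM _ hX q (fun z => z <> pos x) ltac:(definable).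
set c := cmp _ _ in hc; pose r := cup c (pr (neg x) (neg x)).
have Cr : cohen r.
  move=> y [/inp[/hc[yp yx]|/pos_neg//] /inp[/hc[yn _]|/neg_inj yn]].
    by apply: (Cq y).
  by rewrite yn in yx.
apply: (nD r Cr).
  by move=> z zn; apply/inp; left; apply/hc; split;
    [apply: nq|move=> e; rewrite -e in xp].
exists x; split=> //; left; split; last by apply/inp; right.
apply: (invF _ q) => // y nay; have nyx : y <> x by move=> e; rewrite e in nay.
split; split.
- by move=> h; apply/inp; left; apply/hc; split=> // /pos_inj.
- by move=> /inp[/hc[]//|/pos_neg].
- by move=> h; apply/inp; left; apply/hc; split=> // /esym/pos_neg.
- by move=> /inp[/hc[]//|/neg_inj].
Qed.

End OverModel.
End MutuallyGeneric.

(** Both halves of the theorem follow from this: the first by starting from the realization of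
    [GBC_exists], the second because finite orders are countable. *)
Lemma GBC_embedding (M : Type) (E : M -> M -> Prop) (X : set (set M))
    (d : Order.disp_t) (P : porderType d) :
  GBC E X -> countable X -> countable [set: P] ->
  exists e : P -> set (set M),
    [/\ forall p : P, Re_GBC E (e p), order_embedding e
      & forall p : P, X `<=` e p].
Proof.
move=> gX cX cP; have hM := gbc_ZFC gX; have hX := model_of_GBC gX cX.
have singX := model_sing hX.
have [clX _] := classes_GBC gX cX.
have [f finj] := countable_injP [set: P] cP.
have cohen0 : cohen hM (emp hM) by move=> x [h _]; case: (empP h).
have [ps gps] := generic_ex (sub_countable (subset_card_le clX) cX) cohen0.
(* Countability of [P] gives its elements distinct numerals, hence disjoint slices. *)
pose num p := numeral hM (f p).
have num_inj p q : num p = num q -> p = q.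
  by move=> /numeral_inj; apply: finj; rewrite ?inE.
pose I p : set M := [set num q | q in [set q | (q <= p)%O]].
pose Y p := slice_extension hM X ps (I p).
have hY p : model E (Y p) by exact: model_slice_extension.
have XY p : X `<=` classes E (Y p).
  by move=> A XA; apply: dfn_cls0; left.
exists (fun p => classes E (Y p)); split=> [p|p q|//].
  apply: (GBC_of_model hM) => //.
  by have [F XF bF] := gbc_global_choice gX; exists F => //; apply: XY.
split=> [pq A|sub_pq].
  apply: dfn_sub => B [XB|[_ [r /= rp <-] ->]]; [by left|right].
  by exists (num r) => //; exists r => //=; exact: Order.POrderTheory.le_trans rp pq.
(* The slice labelled by [p] is a class of the image of [p], but not of the image of [q], whose
   labels all come from elements below [q]. *)
apply: contrapT => npq.
have notI : ~ I q (num p) by move=> [r /= rq /num_inj rp]; apply: npq; rewrite -rp.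
apply: (generic_slice_notin hX gps notI); apply: sub_pq.
by apply: dfn_cls0; right; exists (num p) => //; exists p => /=.
Qed.

Theorem theorem1p76 (M : Type) (E : M -> M -> Prop)
    (hM : ZFC E) (hcount : countable [set: M]) :
  (forall (d : Order.disp_t) (P : porderType d), countable [set: P] ->
     exists e : P -> set (set M),
       (forall p : P, Re_GBC E (e p)) /\ order_embedding e) /\
  (forall (d : Order.disp_t) (P : finPOrderType d) (X : set (set M)),
     Re_GBC E X -> countable X ->
     exists e : P -> set (set M),
       [/\ forall p : P, Re_GBC E (e p), order_embedding e
         & forall p : P, X `<=` e p]).
Proof.
split=> [d P cP|d P X gX cX]; last first.
  by apply: GBC_embedding gX cX _; exact: countableP.
have [X gX cX] := GBC_exists hM hcount.
by have [e [eP e_emb _]] := GBC_embedding gX cX cP; exists e.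
Qed.
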